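(* Let $0<s<1$ and consider directed first passage site percolation on the $n\times n$ grid with i.i.d. Bernoulli($s$) vertex weights. Suppose that the curvature power $\kappa$ of the shape function $g$ at $(1,1)$ satisfies $1\le\kappa<+\infty$. Then, with probability exponentially close to $1$, all the geodesics from $(0,0)$ to $(n,n)$ are within the cylinder centered on the main diagonal and of width $O\big(n^{\frac{2\kappa+2}{2\kappa+3}}\sqrt{\ln n}\big)$. That is, there exist constants $C>0$, $a>0$ and $N$ (not depending on $n$) such that for all $n\ge N$, with probability at least $1-2\exp(-n^{a})$, every vertex $(x,y)$ of every geodesic from $(0,0)$ to $(n,n)$ satisfies $|x-y|\le C\,n^{\frac{2\kappa+2}{2\kappa+3}}\sqrt{\ln n}$.
   Context: Model: the vertices of the grid are $v\in\{0,1,\dots,n\}^2$, each carrying a weight $w(v)\in\{0,1\}$; all weights are independent with $\mathbb{P}(w(v)=1)=s=1-\mathbb{P}(w(v)=0)$, $0<s<1$. A directed path from $(0,0)$ to $(n_1,n_2)$ is a sequence of vertices $v_0=(0,0),v_1,\dots,v_{n_1+n_2}=(n_1,n_2)$ with each increment $v_{i+1}-v_i\in\{(1,0),(0,1)\}$. The directed first passage time is $T(n_1,n_2)=\min_{\pi}\sum_{v\in\pi\setminus\{(0,0)\}}w(v)$, the minimum being over all directed paths $\pi$ from $(0,0)$ to $(n_1,n_2)$ (the weight at the starting vertex is excluded). A geodesic from $(0,0)$ to $(n,n)$ is any directed path attaining $T(n,n)$. Shape function: $g(x,y)=\lim_{n\to\infty}\mathbb{E}T(nx,ny)/n$ for $x,y>0$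 (coordinates $nx,ny$ rounded down to integers); in this first passage setting $g$ is symmetric and convex. Put $g_\perp(q)=g(1-q,1+q)$ for $q\in(-1,1)$. Curvature power at $(1,1)$: if $g$ is differentiable at $(1,1)$, then $g$ has curvature power $\kappa$ at $(1,1)$ if there exist $\delta>0$ and positive constants $c,C'$ such that $c|z|^{\kappa}\le |g((1,1)+z)-g(1,1)|\le C'|z|^{\kappa}$ for all $z\in\mathbb{R}^2$ with $z\cdot(1,1)=0$ and $|z|<\delta$; if $g$ is not differentiable at $(1,1)$, set $\kappa=1$. The requirement $1\le\kappa<\infty$ is equivalent to: there exist $\delta>0$ and $c,C'>0$ with $c|q|^{\kappa}\le|g_\perp(q)-g_\perp(0)|\le C'|q|^{\kappa}$ for all $q\in(-1,1)$ with $|q|<\delta$. *)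

(* Defs.v *)
From HB Require Import structures.
From mathcomp Require Import all_boot all_order all_algebra finmap.
From mathcomp Require Import all_classical all_reals all_analysis.

Set Implicit Arguments.
Unset Strict Implicit.
Unset Printing Implicit Defensive.

Import Order.TTheory GRing.Theory Num.Theory numFieldNormedType.Exports.

Local Open Scope classical_set_scope.
Local Open Scope ring_scope.

Definition vertex := (nat * nat)%type.

Definition origin : vertex := (0, 0)%N.

Definition step : rel vertex := fun u v =>
  (v == (u.1.+1, u.2)) || (v == (u.1, u.2.+1)).

(* A directed path from the origin is represented by the sequence p of its
   vertices other than the origin; its full vertex sequence is origin :: p. *)
Definition dpath (m : vertex) (p : seq vertex) : bool :=
  path step origin p && (last origin p == m).

(* A weight configuration c is boolean valued, true standing for weight 1.
   Since p omits the origin, so does the sum. *)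
Definition passage_time (c : vertex -> bool) (p : seq vertex) : nat :=
  (\sum_(v <- p) c v)%N.

Lemma dpath_exists (m : vertex) : exists p, dpath m p.
Proof.
case: m => a b; elim: a => [|a [p /andP[pp /eqP pl]]].
  elim: b => [|b [p /andP[pp /eqP pl]]]; first by exists [::]; rewrite /dpath /=.
  exists (rcons p (0, b.+1)%N).
  by rewrite /dpath rcons_path last_rcons pp pl /step /= !eqxx ?orbT.
exists (rcons p (a.+1, b)).
by rewrite /dpath rcons_path last_rcons pp pl /step /= !eqxx.
Qed.

Lemma passage_time_exists (c : vertex -> bool) (m : vertex) :
  exists t, `[< exists2 p, dpath m p & passage_time c p = t >].
Proof.
by have [p mp] := dpath_exists m; exists (passage_time c p); apply/asboolP; exists p.
Qed.

Definition fpt (c : vertex -> bool) (m : vertex) : nat :=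
  ex_minn (passage_time_exists c m).

Definition geodesic (c : vertex -> bool) (m : vertex) (p : seq vertex) : Prop :=
  dpath m p /\ passage_time c p = fpt c m.

Definition mutually_independent (R : realType) (d d' : measure_display)
    (Om : measurableType d) (S : measurableType d') (I : choiceType)
    (P : probability Om R) (X : I -> {RV P >-> S}) : Prop :=
  forall (A : {fset I}) (E : I -> set S), (forall i, measurable (E i)) ->
    P (\bigcap_(i in [set` A]) (X i @^-1` E i))
    = (\prod_(i <- A) P (X i @^-1` E i))%E.

Definition iid_bernoulli (R : realType) (d : measure_display)
    (Om : measurableType d) (P : probability Om R) (s : R)
    (w : vertex -> {RV P >-> bool}) : Prop :=
  mutually_independent w /\ forall v, P (w v @^-1` [set true]) = s%:E.

Definition mean_fpt (R : realType) (d : measure_display)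
    (Om : measurableType d) (P : probability Om R)
    (w : vertex -> {RV P >-> bool}) (m : vertex) : R :=
  fine 'E_P[fun om => (fpt (fun v => w v om) m)%:R].

(* Num.truncn is the floor on nonnegative arguments. Only the values with both
   coordinates positive are meaningful. *)
Definition shape_function (R : realType) (d : measure_display)
    (Om : measurableType d) (P : probability Om R)
    (w : vertex -> {RV P >-> bool}) (z : R * R) : R :=
  limn (fun n : nat =>
    mean_fpt w (Num.truncn (n%:R * z.1), Num.truncn (n%:R * z.2)) / n%:R : R).

(* The norm that the library puts on R * R is the sup norm. *)
Definition enorm (R : realType) (z : R * R) : R :=
  Num.sqrt (z.1 ^+ 2 + z.2 ^+ 2).

Definition curvature_power_at11 (R : realType) (g : R * R -> R) (k : R) : Prop :=
  let e : R * R := (1, 1) in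
  (differentiable g e ->
     exists delta c C' : R, [/\ 0 < delta, 0 < c, 0 < C' &
       forall z : R * R, z.1 * e.1 + z.2 * e.2 = 0 -> enorm z < delta ->
         c * enorm z `^ k <= `|g (e + z) - g e| <= C' * enorm z `^ k]) /\
  (~ differentiable g e -> k = 1).

(* Main.v *)
Require Import Defs.
From HB Require Import structures.
From mathcomp Require Import all_boot all_order all_algebra finmap.
From mathcomp Require Import all_classical all_reals all_analysis.
From mathcomp Require Import measurable_realfun.
From mathcomp Require Import zify ring lra.

Set Implicit Arguments.
Unset Strict Implicit.
Unset Printing Implicit Defensive.

Import Order.TTheory GRing.Theory Num.Theory numFieldNormedType.Exports.

Local Open Scope classical_set_scope.
Local Open Scope ring_scope.

(** Why the theorem holds. Write tau m for the mean passage time to the vertex m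
and gamma for the shape function at (1,1).

Concentration. A directed path meets each antidiagonal at most once, so changing
all the weights of one antidiagonal moves a passage time by at most 1. Grouping
the independent weights by antidiagonals therefore gives a bounded differences
inequality with only L blocks for a target at level x + y = L, although of
order L^2 weights are involved ([deviation_prob]). Outside an event of
probability at most 2 exp(- L^a), all the passage times from the origin to v
and from v to u, for v in the box below u, are within t = L^b of their means,
with a = 1/(2k+3) and b = (k+3)/(2k+3) = (1+3a)/2 ([atypical_prob],
[err_scale_eventually]).

Nonrandom error. On a typical configuration the geodesic to u crosses any given
antidiagonal at some v, whence tau u >= tau v + tau (u - v) - 3t: the means are
almost superadditive along antidiagonals ([mean_superadd]). By the symmetry of
the model, tau v >= tau (n,n) / 2 for every v on the antidiagonal x + y = n.
Doubling the level again and again keeps this lower bound up to a geometric sum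
of errors, and comparison with the limit gives
tau (n,n) <= n gamma + O(n^b) ([mean_diag_le_shape]).

Shape function. Up to a constant the means are subadditive over the real
quadrant, so the shape function exists, is homogeneous, subadditive and
symmetric, and lies below the means. Its excess over the diagonal value,
bend q = g(1-q,1+q) - g(1,1), is at least c |q|^k on all of [-1,1]: this comes
from the curvature assumption and convexity when g is differentiable at (1,1);
when bend is not at least linear, convexity makes it flat at 0 and g is
differentiable ([bend_ge_power], [differentiable_flat]).

Conclusion. If a geodesic to (n,n) passes through v with |x - y| = D, then on a
typical configuration n gamma + c n (D / 2n)^k <= tau v + tau ((n,n) - v) + O(1)
<= tau (n,n) + O(n^b) <= n gamma + O(n^b), so D is at most of order
n^(1 - (1-b)/k) = n^((2k+2)/(2k+3)) ([typical_geodesics]). *)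

(** * Exponential bounds and averages over finitely many independent weights *)

Section ExpBounds.
Variable R : realType.

(** From exp(-y/2) >= 1 - y/2, that is exp y <= (1 - y/2)^(-2), and polynomial
arithmetic. *)
Lemma expR_le_quad (y : R) : `|y| <= 1 / 3 -> expR y <= 1 + y + y ^+ 2.
Proof.
rewrite ler_norml => /andP[y1 y2].
have h := expR_ge1Dx (- (y / 2)).
have e : expR y * (expR (- (y / 2)) ^+ 2) = 1.
  by rewrite -expRM_natl -expRD -[RHS]expR0; congr expR; field.
have h2 : (1 - y / 2) ^+ 2 <= expR (- (y / 2)) ^+ 2.
  by rewrite ler_sqr ?nnegrE; lra.
have h3 : expR y * (1 - y / 2) ^+ 2 <= 1.
  by rewrite -[leRHS]e ler_wpM2l ?expR_ge0.
have h4 : 1 <= (1 + y + y ^+ 2) * (1 - y / 2) ^+ 2.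
  have -> : (1 + y + y ^+ 2) * (1 - y / 2) ^+ 2
     = 1 + y ^+ 2 * ((1 - 3 * y + y ^+ 2) / 4) by field.
  by rewrite lerDl mulr_ge0 ?sqr_ge0// divr_ge0// addr_ge0 ?sqr_ge0//; lra.
have p : 0 < (1 - y / 2) ^+ 2 by rewrite exprn_gt0; lra.
by rewrite -(ler_pM2r p) (le_trans h3).
Qed.

Lemma expR1_le3 : expR 1 <= 3 :> R.
Proof.
have -> : expR 1 = expR (1 / 4) ^+ 4 :> R.
  by rewrite -expRM_natl; congr expR; field.
have q : expR (1 / 4) <= 1 + 1 / 4 + (1 / 4) ^+ 2 :> R.
  by apply: expR_le_quad; rewrite ger0_norm; lra.
apply: (@le_trans _ _ ((1 + 1 / 4 + (1 / 4) ^+ 2) ^+ 4)).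
  by rewrite lerXn2r ?nnegrE ?expR_ge0//; lra.
lra.
Qed.

End ExpBounds.

Section Averages.
Variables (R : realType) (s : R) (I : eqType).
Implicit Types (l D : seq I) (c : I -> bool) (f g : (I -> bool) -> R).

Definition upd c v b : I -> bool := fun u => if u == v then b else c u.

(** The expectation of [f] when the weights at the entries of [l] are
independent Bernoulli([s]) and the others are frozen to [c]. Defining it by
integrating out one vertex at a time avoids any product measure. *)
Fixpoint avg l f c : R :=
  if l is v :: l' then
    s * avg l' f (upd c v true) + (1 - s) * avg l' f (upd c v false)
  else f c.

Definition agree_off l c c' := forall u, u \notin l -> c u = c' u.

Definition local_to (T : Type) l (f : (I -> bool) -> T) :=
  forall c c', {in l, c =1 c'} -> f c = f c'.

Lemma sub_local (T : Type) l l' (f : (I -> bool) -> T) :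
  {subset l <= l'} -> local_to l f -> local_to l' f.
Proof. by move=> ll' floc c c' cc'; apply: floc => u /ll' /cc'. Qed.

Lemma agree_off_upd l c c' v b : agree_off l c c' ->
  agree_off l (upd c v b) (upd c' v b).
Proof. by move=> h u ul; rewrite /upd; case: eqP => // _; exact: h. Qed.

Lemma agree_off_upd_cons l c c' v b : agree_off l (upd c v b) c' ->
  agree_off (v :: l) c c'.
Proof.
by move=> h u; rewrite inE negb_or => /andP[/negPf uv ul]; rewrite -h // /upd uv.
Qed.

Lemma avg_cat l1 l2 f c : avg (l1 ++ l2) f c = avg l1 (avg l2 f) c.
Proof. by elim: l1 c => //= v l1 IH c; rewrite !IH. Qed.

Lemma avg_cst l a c : avg l (fun=> a) c = a.
Proof. by elim: l c => //= v l IH c; rewrite !IH; ring. Qed.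

Lemma avgD l f g c : avg l (fun c => f c + g c) c = avg l f c + avg l g c.
Proof. by elim: l c => //= v l IH c; rewrite !IH; ring. Qed.

Lemma avgZ l a f c : avg l (fun c => a * f c) c = a * avg l f c.
Proof. by elim: l c => //= v l IH c; rewrite !IH; ring. Qed.

Hypotheses (s_ge0 : 0 <= s) (s_le1 : s <= 1).

(** Averaging over [l] starting from [c] only evaluates configurations that
agree with [c] off [l], so monotonicity needs no more than those. *)
Lemma avg_le l f g c :
  (forall c', agree_off l c c' -> f c' <= g c') -> avg l f c <= avg l g c.
Proof.
elim: l c => /= [|v l IH] c fg; first exact: fg.
apply: lerD; (apply: ler_wpM2l; first by rewrite ?subr_ge0);
  apply: IH => c' /agree_off_upd_cons; exact: fg.
Qed.

(** Averaging substitutes the same values in both configurations, so it does not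
increase the oscillation along [D]. *)
Lemma avg_osc l D f (a : R) :
  (forall c c', agree_off D c c' -> f c <= f c' + a) ->
  forall c c', agree_off D c c' -> avg l f c <= avg l f c' + a.
Proof.
move=> fD; elim: l => //= v l IH c c' cc'.
have /IH h1 := agree_off_upd v true cc'.
have /IH h2 := agree_off_upd v false cc'.
have := ler_wpM2l s_ge0 h1.
have s1 : 0 <= 1 - s by rewrite subr_ge0.
have := ler_wpM2l s1 h2.
lra.
Qed.

(** The one-block case of the bounded differences method: [f] stays within 1 of
its block average, so [expR_le_quad] applies and its linear term averages out. *)
Lemma avg_expR_block D f (lam : R) c :
  `|lam| <= 1 / 3 ->
  (forall c c', agree_off D c c' -> f c <= f c' + 1) ->
  avg D (fun c => expR (lam * f c)) c <= expR (lam * avg D f c + lam ^+ 2).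
Proof.
move=> lam1 fD; set m := avg D f c.
have near_m c' : agree_off D c c' -> `|f c' - m| <= 1.
  move=> cc'; have h c'' : agree_off D c c'' -> f c' <= f c'' + 1 /\ f c'' <= f c' + 1.
    move=> cc''; split; apply: fD => u uD; first by rewrite -cc' // cc''.
    by rewrite -cc'' // cc'.
  have h1 : f c' - 1 <= m.
    rewrite -[leLHS](avg_cst D _ c); apply: avg_le => c'' /h[]; lra.
  have h2 : m <= f c' + 1.
    rewrite -[leRHS](avg_cst D _ c); apply: avg_le => c'' /h[]; lra.
  by rewrite ler_norml; lra.
rewrite expRD.
apply: (@le_trans _ _ (expR (lam * m) * (1 + lam ^+ 2))); last first.
  by rewrite ler_wpM2l ?expR_ge0 ?expR_ge1Dx.
have -> : expR (lam * m) * (1 + lam ^+ 2) =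
   avg D (fun c' => expR (lam * m) * ((1 + lam ^+ 2 - lam * m) + lam * f c')) c.
  by rewrite avgZ avgD avg_cst avgZ -/m; ring.
apply: avg_le => c' /near_m fm.
have -> : lam * f c' = lam * m + lam * (f c' - m) by ring.
rewrite expRD ler_wpM2l ?expR_ge0//.
have hle : `|lam * (f c' - m)| <= `|lam|.
  by rewrite normrM ler_piMr.
apply: (le_trans (expR_le_quad (le_trans hle lam1))).
have : (lam * (f c' - m)) ^+ 2 <= lam ^+ 2.
  by rewrite -(real_normK (num_real _)) -(real_normK (num_real lam)) lerXn2r ?nnegrE.
lra.
Qed.

(** The Azuma-McDiarmid exponential moment bound. The inner average over the
remaining blocks still has oscillation at most 1 along the first one, so the
one-block bounds multiply. *)
Lemma avg_expR_blocks (Ds : seq (seq I)) f (lam : R) c :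
  `|lam| <= 1 / 3 ->
  {in Ds, forall D, forall c c', agree_off D c c' -> f c <= f c' + 1} ->
  avg (flatten Ds) (fun c => expR (lam * f c)) c <=
    expR (lam * avg (flatten Ds) f c + (size Ds)%:R * lam ^+ 2).
Proof.
move=> lam1; elim: Ds c => [|D Ds IH] c fDs /=.
  by rewrite mul0r addr0.
rewrite !avg_cat.
apply: (@le_trans _ _ (avg D (fun c' => expR ((size Ds)%:R * lam ^+ 2)
   * expR (lam * avg (flatten Ds) f c')) c)).
  apply: avg_le => c' _; rewrite -expRD addrC; apply: IH => D' D'Ds.
  by apply: fDs; rewrite inE D'Ds orbT.
rewrite avgZ.
have -> : lam * avg D (avg (flatten Ds) f) c + (size Ds).+1%:R * lam ^+ 2
  = (size Ds)%:R * lam ^+ 2 + (lam * avg D (avg (flatten Ds) f) c + lam ^+ 2).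
  by rewrite -natr1; ring.
rewrite expRD ler_wpM2l ?expR_ge0//; apply: avg_expR_block => //.
by apply: avg_osc; apply: fDs; rewrite inE eqxx.
Qed.

(** Chernoff's bound; [sgn] is 1 for the upper tail and -1 for the lower one. *)
Lemma avg_tail (Ds : seq (seq I)) f (lam t sgn : R) c :
  sgn ^+ 2 = 1 -> 0 <= lam <= 1 / 3 ->
  {in Ds, forall D, forall c c', agree_off D c c' -> f c <= f c' + 1} ->
  avg (flatten Ds) (fun c' =>
     (t <= sgn * (f c' - avg (flatten Ds) f c))%R%:R) c <=
    expR ((size Ds)%:R * lam ^+ 2 - lam * t).
Proof.
move=> sgn1 /andP[lam0 lam1] fDs; set m := avg _ f c.
apply: (@le_trans _ _ (avg (flatten Ds) (fun c' =>
    expR (- (lam * t) - sgn * lam * m) * expR ((sgn * lam) * f c')) c)).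
  apply: avg_le => c' _; rewrite -expRD; case: (leP t) => tf; last exact: expR_ge0.
  rewrite -expR0 ler_expR.
  have -> : - (lam * t) - sgn * lam * m + sgn * lam * f c' =
     lam * (sgn * (f c' - m) - t) by ring.
  by rewrite mulr_ge0 // subr_ge0.
rewrite avgZ.
have nsgn : `|sgn| = 1.
  by apply/eqP; rewrite -sqr_norm_eq1 sgn1.
have hl : `|sgn * lam| <= 1 / 3.
  by rewrite normrM nsgn (ger0_norm lam0); lra.
have := avg_expR_blocks c hl fDs; rewrite -/m exprMn sgn1 mul1r => h.
apply: (le_trans (ler_wpM2l (expR_ge0 _) h)).
by rewrite -expRD ler_expR; lra.
Qed.

End Averages.

(** Means do not depend on the names of the vertices: this yields both the
translation invariance and the reflection symmetry of the model. *)
Lemma avg_relabel (R : realType) (s : R) (I J : eqType) (phi : J -> I)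
    (h : (J -> bool) -> R) (l : seq J) (c : I -> bool) :
  injective phi ->
  avg s (map phi l) (fun c => h (c \o phi)) c = avg s l h (c \o phi).
Proof.
move=> phiI; elim: l c => //= v l IH c; rewrite !IH.
have E b : upd c (phi v) b \o phi = upd (c \o phi) v b.
  by apply/funext => u /=; rewrite /upd inj_eq.
by rewrite !E.
Qed.

(** * From independent random weights to averages *)

Section Transfer.
Variables (R : realType) (d : measure_display) (Om : measurableType d).
Variables (P : probability Om R) (s : R) (I : choiceType).
Variables (w : I -> {RV P >-> bool}).
Hypotheses (w_indep : mutually_independent w)
  (w_bern : forall v, P (w v @^-1` [set true]) = s%:E).

Definition config (om : Om) : I -> bool := fun v => w v om.

Definition cylinder (A : {fset I}) (c : I -> bool) : set Om :=
  \bigcap_(i in [set` A]) (w i @^-1` [set c i]).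

Lemma measurable_preimage v (E : set bool) : measurable (w v @^-1` E).
Proof. by rewrite -[_ @^-1` _]setTI; exact: (@measurable_funPT _ _ _ _ (w v)). Qed.

Lemma measurable_cylinder A c : measurable (cylinder A c).
Proof.
rewrite /cylinder bigcap_fset; apply: bigsetI_measurable => i _.
exact: measurable_preimage.
Qed.

Lemma weight_law v b : P (w v @^-1` [set b]) = (if b then s else 1 - s)%:E.
Proof.
case: b; first exact: w_bern.
have -> : w v @^-1` [set false] = ~` (w v @^-1` [set true]).
  by apply/seteqP; split => om /=; case: (w v om).
by rewrite probability_setC ?w_bern//; exact: measurable_preimage.
Qed.

Lemma cylinder_law A c :
  P (cylinder A c) = (\prod_(i <- A) (if c i then s else 1 - s))%:E.
Proof.
rewrite /cylinder w_indep // -prodEFin; apply: eq_bigr => i _.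
exact: weight_law.
Qed.

(** By induction on [l], a local function is a finite nesting of case
distinctions on single weights. *)
Lemma measurable_local dT (T : measurableType dT) (l : seq I)
    (f : (I -> bool) -> T) :
  local_to l f -> measurable_fun setT (f \o config).
Proof.
elim: l f => [|v l IH] f floc.
  have -> : f \o config = cst (f (fun=> false)).
    by apply/funext => om /=; apply: floc.
  exact: measurable_cst.
have -> : f \o config = (fun om => if w v om
    then ((fun c => f (upd c v true)) \o config) om
    else ((fun c => f (upd c v false)) \o config) om).
  apply/funext => om /=; case E: (w v om); apply: floc => u _;
    by rewrite /upd /config; case: eqP => // ->.
apply: measurable_fun_ifT; first exact: (@measurable_funPT _ _ _ _ (w v)).
  apply: IH => c c' cc'; apply: floc => u.
  by rewrite inE /upd; case: eqP => //= _ /cc'.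
apply: IH => c c' cc'; apply: floc => u.
by rewrite inE /upd; case: eqP => //= _ /cc'.
Qed.

(** The link between the abstract probability space and the recursion [avg]:
conditioning on one more weight splits the cylinder into two, whose
probabilities are products by independence. *)
Lemma integral_local_cylinder (l : seq I) (A : {fset I}) (f : (I -> bool) -> R) c :
  uniq l -> {in l, forall v, v \notin A} -> (forall c, 0 <= f c) ->
  local_to (enum_fset A ++ l) f ->
  (\int[P]_(om in cylinder A c) (f (config om))%:E =
    (avg s l f c * \prod_(i <- A) (if c i then s else 1 - s))%:E)%E.
Proof.
move=> + + f0.
elim: l A c => [|v l IH] A c /=.
  move=> _ _; rewrite cats0 => floc.
  rewrite (@eq_integral _ _ _ _ _ (cst (f c)%:E)).
    rewrite integral_cst; last exact: measurable_cylinder.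
    by rewrite [X in (_ * X)%E](cylinder_law A c).
  move=> om; rewrite inE => omA /=; congr EFin; apply: floc => i iA.
  exact: omA.
move=> /andP[vl ul] lA floc.
have vA : v \notin A by apply: lA; rewrite inE eqxx.
have splitA : cylinder A c = cylinder (v |` A)%fset (upd c v true) `|`
    cylinder (v |` A)%fset (upd c v false).
  have cylU b om : cylinder (v |` A)%fset (upd c v b) om <->
      cylinder A c om /\ w v om = b.
    split.
      move=> h; split.
        move=> i /= iA; have := h i; rewrite /= /upd in_fset1U iA orbT.
        by case: eqP => [iv|_ ->//]; rewrite -iv iA in vA.
      by have := h v; rewrite /= /upd in_fset1U eqxx => ->.
    move=> [h wv] i /=; rewrite in_fset1U /upd; case: eqP => [-> _//|_ /= iA].
    exact: h.
  apply/seteqP; split => om.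
    by move=> h; case E: (w v om); [left|right]; apply/cylU.
  by move=> [] /cylU[].
have mf : @measurable_fun _ _ Om (\bar R) setT (EFin \o (f \o config)).
  by apply/measurable_EFinP; exact: measurable_local floc.
rewrite splitA ge0_integral_setU; last first.
  - apply/disj_set2P/seteqP; split => // om [].
    move=> /(_ v) /= + /(_ v) /=.
    by rewrite /upd in_fset1U eqxx /= => -> // /(_ erefl).
  - by move=> om _; rewrite lee_fin.
  - exact: measurable_funTS.
  - exact: measurable_cylinder.
  - exact: measurable_cylinder.
have step b : (\int[P]_(om in cylinder (v |` A)%fset (upd c v b)) (f (config om))%:E
   = (avg s l f (upd c v b) * ((if b then s else 1 - s) *
       \prod_(i <- A) (if c i then s else 1 - s)))%:E)%E.
  rewrite IH //; first last.
  - apply: sub_local floc => u; rewrite !mem_cat !inE => /or3P[] h; rewrite ?h ?orbT//.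
  - move=> u ul'; rewrite in_fset1U negb_or; apply/andP; split.
      by apply: contraNneq vl => <-.
    by apply: lA; rewrite inE ul' orbT.
  congr (_ * _)%:E; rewrite big_fsetU1 //=; congr (_ * _).
    by rewrite /upd eqxx.
  rewrite big_seq [RHS]big_seq; apply: eq_bigr => i iA.
  by rewrite /upd; case: eqP => // iv; rewrite -iv iA in vA.
rewrite !step -EFinD; congr EFin; ring.
Qed.

Lemma integral_local (l : seq I) (f : (I -> bool) -> R) c :
  uniq l -> (forall c, 0 <= f c) -> local_to l f ->
  (\int[P]_om (f (config om))%:E = (avg s l f c)%:E)%E.
Proof.
move=> ul f0 floc.
have := @integral_local_cylinder l fset0 f c ul (fun _ _ => isT) f0 floc.
by rewrite /cylinder set_fset0 bigcap_set0 big_seq_fset0 mulr1.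
Qed.

Definition event (Q : (I -> bool) -> bool) : set Om := [set om | Q (config om)].

Lemma measurable_event l (Q : (I -> bool) -> bool) :
  local_to l Q -> measurable (event Q).
Proof.
move=> Qloc; rewrite -[event Q]setTI.
exact: (@measurable_local _ bool l Q Qloc measurableT [set true]).
Qed.

Lemma probability_event (l : seq I) (Q : (I -> bool) -> bool) c :
  uniq l -> local_to l Q -> P (event Q) = (avg s l (fun c => (Q c)%:R) c)%:E.
Proof.
move=> ul Qloc; rewrite -(integral_local c ul) //; last first.
  by move=> c1 c2 /Qloc ->.
have := integral_indic P measurableT (measurable_event Qloc).
rewrite setIT => <-.
apply: eq_integral => om _; rewrite indicE; congr ((_ _)%:R%:E).
by apply/idP/idP; rewrite inE.
Qed.

End Transfer.

(** * Directed paths and passage times *)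

Section PassageTimes.
Local Open Scope nat_scope.
Implicit Types (u v m : vertex) (p : seq vertex) (c : vertex -> bool).

Definition level v := v.1 + v.2.
Definition translate v m : vertex := (v.1 + m.1, v.2 + m.2).
Definition swap v : vertex := (v.2, v.1).
Definition antidiag i : seq vertex := [seq (j, i - j) | j <- iota 0 i.+1].
Arguments antidiag : simpl never.
Definition antidiags N : seq (seq vertex) := [seq antidiag i | i <- iota 1 N].
Definition grid N : seq vertex := flatten (antidiags N).

Lemma translate_inj v : injective (translate v).
Proof. by move=> [a b] [a' b'] [] /addnI-> /addnI->. Qed.

Lemma swapK : involutive swap. Proof. by case. Qed.

Lemma level_translate v m : level (translate v m) = level v + level m.
Proof. by rewrite /level /=; lia. Qed.

Lemma mem_antidiag i v : (v \in antidiag i) = (level v == i).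
Proof.
case: v => a b; rewrite /level /=; apply/mapP/eqP => [[j]|<-].
  by rewrite mem_iota => /andP[_ ji] [-> ->]; lia.
by exists a; [rewrite mem_iota; lia | congr (_, _); lia].
Qed.

Lemma mem_grid N v : (v \in grid N) = (0 < level v <= N).
Proof.
apply/flatten_mapP/idP => [[i]|vN].
  by rewrite mem_iota mem_antidiag => + /eqP ->; lia.
by exists (level v); rewrite ?mem_antidiag // mem_iota; lia.
Qed.

Lemma uniq_grid N : uniq (grid N).
Proof.
rewrite /grid /antidiags; move: 1 => a; elim: N a => // N IH a.
have -> : flatten [seq antidiag i | i <- iota a N.+1] =
  antidiag a ++ flatten [seq antidiag i | i <- iota a.+1 N] by [].
rewrite cat_uniq IH andbT; apply/andP; split.
  by rewrite /antidiag map_inj_uniq ?iota_uniq// => x y [].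
apply/hasPn => v /flatten_mapP[i]; rewrite mem_iota mem_antidiag => ai /eqP vi.
by rewrite /= mem_antidiag; lia.
Qed.

Lemma fptP c m : exists p, geodesic c m p.
Proof.
rewrite /geodesic /fpt; case: ex_minnP => t /asboolP[p dp pt] _.
by exists p.
Qed.

Lemma fpt_le c m p : dpath m p -> fpt c m <= passage_time c p.
Proof.
move=> dp; rewrite /fpt; case: ex_minnP => t _; apply.
by apply/asboolP; exists p.
Qed.

Lemma fpt_le_add c c' m a :
  (forall p, dpath m p -> passage_time c p <= passage_time c' p + a) ->
  fpt c m <= fpt c' m + a.
Proof.
by move=> h; have [p [dp <-]] := fptP c' m; exact: leq_trans (fpt_le c dp) (h p dp).
Qed.

Lemma step_level u v : step u v -> level v = (level u).+1.
Proof. by rewrite /step /level => /orP[] /eqP -> /=; lia. Qed.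

Lemma map_level_path u p : path step u p ->
  map level p = iota (level u).+1 (size p).
Proof.
elim: p u => //= v p IH u /andP[uv /IH ->].
by rewrite (step_level uv).
Qed.

Lemma level_last u p : path step u p -> level (last u p) = level u + size p.
Proof.
elim: p u => [|v p IH] u /=; first by rewrite addn0.
by move=> /andP[/step_level uv /IH ->]; rewrite uv addSnnS.
Qed.

Lemma dpath_size m p : dpath m p -> size p = level m.
Proof. by move=> /andP[pp /eqP <-]; rewrite level_last. Qed.

Lemma dpath_level m p v : dpath m p -> v \in p -> 0 < level v <= level m.
Proof.
move=> dp vp; have /andP[pp _] := dp.
have := map_f level vp; rewrite (map_level_path pp) mem_iota (dpath_size dp).
by rewrite /level /=; lia.
Qed.

Lemma eq_passage_time c c' p : {in p, c =1 c'} ->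
  passage_time c p = passage_time c' p.
Proof.
by move=> cc'; rewrite /passage_time !big_seq; apply: eq_bigr => v /cc' ->.
Qed.

Lemma passage_time_local m p : dpath m p ->
  local_to (grid (level m)) (passage_time ^~ p).
Proof.
move=> dp c c' cc'; apply: eq_passage_time => v vp; apply: cc'.
by rewrite mem_grid (dpath_level dp).
Qed.

Lemma fpt_local m N : level m <= N ->
  local_to (grid N) (fpt ^~ m).
Proof.
move=> mN; apply: (@sub_local _ _ (grid (level m))).
  by move=> v; rewrite !mem_grid; lia.
move=> c c' cc'; apply/eqP; rewrite eqn_leq; apply/andP; split.
  rewrite -[leqRHS]addn0; apply: fpt_le_add => p dp.
  by rewrite (passage_time_local dp cc') addn0.
rewrite -[leqRHS]addn0; apply: fpt_le_add => p dp.
by rewrite (passage_time_local dp cc') addn0.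
Qed.

(** The key to concentration: the levels along a path are consecutive integers,
so at most one vertex of the path lies on a given antidiagonal. *)
Lemma fpt_antidiag_lip i m c c' :
  agree_off (antidiag i) c c' -> fpt c m <= fpt c' m + 1.
Proof.
move=> cc'; apply: fpt_le_add => p /andP[pp _].
apply: (@leq_trans (\sum_(v <- p) (c' v + (level v == i)))).
  apply: leq_sum => v _; have [vi|vi] := eqVneq; first by case: (c v); case: (c' v).
  by rewrite cc' ?leq_addr // mem_antidiag.
rewrite big_split /= leq_add2l.
have -> : \sum_(v <- p) (level v == i : nat) = count_mem i (map level p).
  rewrite count_map -sum1_count [RHS]big_mkcond.
  by apply: eq_bigr => v _ /=; case: eqP.
by rewrite (map_level_path pp) count_uniq_mem ?iota_uniq // leq_b1.
Qed.

Lemma fpt_le_level c m : fpt c m <= level m.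
Proof.
have [p [dp <-]] := fptP c m; rewrite -(dpath_size dp) -sum1_size.
by apply: leq_sum => v _; case: (c v).
Qed.

Lemma path_translate v a p : path step (translate v a) (map (translate v) p) = path step a p.
Proof.
elim: p a => //= u p IH a; rewrite IH; congr andb.
by rewrite /step /translate !xpair_eqE !eqn_add2l -!addnS !eqn_add2l.
Qed.

Lemma path_untranslate v a p : path step (translate v a) p ->
  exists2 q, p = map (translate v) q & path step a q.
Proof.
elim: p a => [|x p IH] a /=; first by exists [::].
case/andP=> ax; have [b -> ab] : exists2 b, x = translate v b & step a b.
  move: ax; rewrite {1}/step => /orP[] /eqP ->.
    by exists (a.1.+1, a.2); rewrite /translate /step /= ?addnS ?eqxx.
  by exists (a.1, a.2.+1); rewrite /translate /step /= ?addnS ?eqxx ?orbT.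
by move=> /IH[q -> aq]; exists (b :: q) => //=; rewrite ab.
Qed.

Lemma translate0 v : translate v origin = v.
Proof. by case: v => a b; rewrite /translate /= !addn0. Qed.

Lemma passage_time_cat c p q :
  passage_time c (p ++ q) = passage_time c p + passage_time c q.
Proof. by rewrite /passage_time big_cat. Qed.

Lemma passage_time_translate c v p :
  passage_time c (map (translate v) p) = passage_time (c \o translate v) p.
Proof. by rewrite /passage_time big_map. Qed.

Lemma fpt_subadd c v m : fpt c (translate v m) <= fpt c v + fpt (c \o translate v) m.
Proof.
have [p [dp <-]] := fptP c v; have [q [dq <-]] := fptP (c \o translate v) m.
rewrite -passage_time_translate -passage_time_cat; apply: fpt_le.
have /andP[pp /eqP lp] := dp; have /andP[pq /eqP lq] := dq.
rewrite /dpath cat_path last_cat pp lp.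
have := path_translate v origin q; rewrite translate0 => ->.
have := last_map (translate v) q origin; rewrite translate0 => ->.
by rewrite pq lq eqxx.
Qed.

(** Cutting a path at [v]; the second half, seen from [v], is a path from the
origin in the translated configuration. *)
Lemma dpath_split c u p v : dpath u p -> v \in origin :: p ->
  exists2 m, u = translate v m &
    fpt c v + fpt (c \o translate v) m <= passage_time c p.
Proof.
move=> /andP[+ /eqP +] vp; case/splitPl: vp => p1 p2 lp1.
have pu r : path step v r -> exists2 q, r = map (translate v) q & path step origin q.
  by rewrite -{1}[v]translate0; exact: path_untranslate.
rewrite cat_path last_cat lp1 => /andP[pp1 /pu[q -> pq]].
have := last_map (translate v) q origin; rewrite translate0 => -> <-.
exists (last origin q) => //.
rewrite passage_time_cat passage_time_translate leq_add //; apply: fpt_le.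
  by rewrite /dpath pp1 lp1 eqxx.
by rewrite /dpath pq eqxx.
Qed.

Lemma fpt_cross c u i : i <= level u ->
  exists v m, [/\ u = translate v m, level v = i &
    fpt c v + fpt (c \o translate v) m <= fpt c u].
Proof.
move=> iu; have [p [dp <-]] := fptP c u.
have /andP[pp _] := dp; pose v := nth origin (origin :: p) i.
have ip : i <= size p by rewrite (dpath_size dp).
have vp : v \in origin :: p by rewrite mem_nth.
have [m um h] := dpath_split c dp vp; exists v, m; split => //.
have : nth 0 (map level (origin :: p)) i = level v by rewrite (nth_map origin).
move=> <-; rewrite /= (map_level_path pp) -[_ :: _]/(iota 0 (size p).+1).
by rewrite nth_iota.
Qed.

Lemma path_swap a p : path step (swap a) (map swap p) = path step a p.
Proof.
elim: p a => //= u p IH a; rewrite IH; congr andb.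
by rewrite /step /swap !xpair_eqE orbC andbC [X in _ || X]andbC.
Qed.

Lemma fpt_swap c m : fpt c (swap m) = fpt (c \o swap) m.
Proof.
have swap_le c' m' : fpt c' (swap m') <= fpt (c' \o swap) m'.
  have [p [/andP[pp /eqP lp] <-]] := fptP (c' \o swap) m'.
  have -> : passage_time (c' \o swap) p = passage_time c' (map swap p).
    by rewrite /passage_time big_map.
  apply: fpt_le; rewrite /dpath -[origin]/(swap origin) path_swap pp last_map lp.
  exact: eqxx.
apply/eqP; rewrite eqn_leq swap_le /=.
have := swap_le (c \o swap) (swap m); rewrite swapK.
by congr (_ <= fpt _ _); apply/funext => v /=; rewrite swapK.
Qed.

End PassageTimes.

(** * Concentration of passage times *)

Lemma local_relabel (I J : eqType) (T : Type) (phi : I -> J) (l : seq I)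
    (f : (I -> bool) -> T) :
  local_to l f -> local_to (map phi l) (fun c => f (c \o phi)).
Proof. by move=> fl c c' cc'; apply: fl => u ul /=; apply: cc'; exact: map_f. Qed.

Lemma fpt_translate_local v m N : (level v + level m <= N)%N ->
  local_to (grid N) (fun c => fpt (c \o translate v) m).
Proof.
move=> vmN; have fl := local_relabel (phi := translate v) (fpt_local (leqnn (level m))).
apply: (sub_local _ fl) => u /mapP[x]; rewrite !mem_grid => xm ->.
by rewrite level_translate; lia.
Qed.

Definition box (u : vertex) : seq vertex :=
  [seq (i, j) | i <- iota 0 u.1.+1, j <- iota 0 u.2.+1].

Definition rest (u v : vertex) : vertex := (u.1 - v.1, u.2 - v.2)%N.

Lemma mem_box v m : v \in box (translate v m).
Proof. by case: v => a b; apply: allpairs_f; rewrite mem_iota /=; lia. Qed.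

Lemma rest_translate v m : rest (translate v m) v = m.
Proof. by case: m => a b; rewrite /rest /= !addKn. Qed.

Lemma box_level u v : v \in box u -> (level v + level (rest u v) = level u)%N.
Proof.
move=> /allpairsP[[i j] [hi hj ->]].
by move: hi hj; rewrite !mem_iota /level /rest /=; lia.
Qed.

Section Typical.
Variables (R : realType) (d : measure_display) (Om : measurableType d).
Variables (P : probability Om R) (w : vertex -> {RV P >-> bool}).

Definition deviates (t : R) m c := t <= `|(fpt c m)%:R - mean_fpt w m|.

Lemma deviates_local t m N : (level m <= N)%N -> local_to (grid N) (deviates t m).
Proof. by move=> mN c c' /(fpt_local mN); rewrite /deviates => ->. Qed.

(** Outside this event both halves of a geodesic to [u], cut at any of its
vertices, have passage times close to their means; the second half is read in
the translated configuration. *)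
Definition atypical (t : R) u c := has (fun v =>
  deviates t v c || deviates t (rest u v) (c \o translate v)) (box u).

Lemma atypical_local t u : local_to (grid (level u)) (atypical t u).
Proof.
move=> c c' cc'; apply: eq_in_has => v /box_level vu.
have h1 : (level v <= level u)%N by lia.
have h2 : (level v + level (rest u v) <= level u)%N by lia.
by rewrite (deviates_local t h1 cc') /deviates (fpt_translate_local h2 cc').
Qed.

Lemma typicalP t u c : ~~ atypical t u c -> forall v m, u = translate v m ->
  `|(fpt c v)%:R - mean_fpt w v| < t /\ `|(fpt (c \o translate v) m)%:R - mean_fpt w m| < t.
Proof.
move=> /hasPn h v m um; have := h v; rewrite um mem_box rest_translate => /(_ isT).
by rewrite negb_or /deviates -!ltNge => /andP.
Qed.

Lemma union_bound (T : eqType) (vs : seq T) N (B : T -> (vertex -> bool) -> bool) (e : R) :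
  (forall v, v \in vs -> local_to (grid N) (B v)) ->
  (forall v, v \in vs -> P (event w (B v)) <= e%:E)%E ->
  (P (event w (fun c => has (fun v => B v c) vs)) <= ((size vs)%:R * e)%:E)%E.
Proof.
elim: vs => [|v vs IH] Bl Be /=.
  rewrite mul0r (_ : event _ _ = set0) ?measure0//.
  by apply/seteqP; split.
have -> : event w (fun c => B v c || has (fun v => B v c) vs) =
   event w (B v) `|` event w (fun c => has (fun v => B v c) vs).
  by apply/seteqP; split => om /= /orP.
apply: (@le_trans _ _ (P (event w (B v)) + P (event w (fun c => has (fun v => B v c) vs)))%E).
  apply: measureU2.
    by apply: (@measurable_event _ _ _ _ _ w (grid N)); apply: Bl; rewrite inE eqxx.
  apply: (@measurable_event _ _ _ _ _ w (grid N)) => c c' cc'.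
  apply: eq_in_has => u uvs; apply: Bl cc'.
  by rewrite inE uvs orbT.
rewrite -nat1r mulrDl mul1r EFinD leeD//.
  by apply: Be; rewrite inE eqxx.
by apply: IH => u uvs; [apply: Bl|apply: Be]; rewrite inE uvs orbT.
Qed.

End Typical.

Section Concentration.
Variables (R : realType) (d : measure_display) (Om : measurableType d).
Variables (P : probability Om R) (s : R) (w : vertex -> {RV P >-> bool}).
Hypotheses (s_gt0 : 0 < s) (s_lt1 : s < 1) (w_iid : iid_bernoulli s w).

Let s_ge0 : 0 <= s := ltW s_gt0.
Let s_le1 : s <= 1 := ltW s_lt1.
Let w_indep : mutually_independent w := w_iid.1.
Let w_bern : forall v, P (w v @^-1` [set true]) = s%:E := w_iid.2.

Definition expect (f : (vertex -> bool) -> R) : R :=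
  fine (\int[P]_om (f (config w om))%:E)%E.

Let none : vertex -> bool := fun=> false.

Lemma expectE l f : uniq l -> (forall c, 0 <= f c) -> local_to l f ->
  expect f = avg s l f none.
Proof. by move=> ul f0 fl; rewrite /expect (integral_local w_indep w_bern none ul f0 fl). Qed.

Lemma expect_relabel (phi : vertex -> vertex) l f : injective phi ->
  uniq l -> (forall c, 0 <= f c) -> local_to l f ->
  expect (fun c => f (c \o phi)) = expect f.
Proof.
move=> phiI ul f0 fl; rewrite (expectE ul f0 fl).
rewrite (@expectE (map phi l)) ?map_inj_uniq//; last exact: local_relabel.
exact: avg_relabel.
Qed.

Lemma probability_relabel (phi : vertex -> vertex) l (Q : (vertex -> bool) -> bool) :
  injective phi -> uniq l -> local_to l Q ->
  P (event w (fun c => Q (c \o phi))) = P (event w Q).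
Proof.
move=> phiI ul Ql.
rewrite [LHS](@probability_event _ _ _ _ _ _ _ w_indep w_bern (map phi l) _ none)
  ?map_inj_uniq//; last exact: local_relabel.
rewrite [RHS](@probability_event _ _ _ _ _ _ _ w_indep w_bern l _ none)//.
by congr EFin; exact: (@avg_relabel _ _ _ _ _ (fun c => (Q c)%:R)).
Qed.

Lemma expect_fpt m : expect (fun c => (fpt c m)%:R) = mean_fpt w m.
Proof. by rewrite /mean_fpt unlock. Qed.

Lemma mean_avg m N : (level m <= N)%N ->
  mean_fpt w m = avg s (grid N) (fun c => (fpt c m)%:R) none.
Proof.
move=> mN; rewrite -expect_fpt; apply: expectE => //.
  exact: uniq_grid.
by move=> c c' /(fpt_local mN) ->.
Qed.

Lemma mean_avg_translate v m N : (level v + level m <= N)%N ->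
  mean_fpt w m = avg s (grid N) (fun c => (fpt (c \o translate v) m)%:R) none.
Proof.
move=> vmN; rewrite -(@expectE (grid N)) ?uniq_grid//; last first.
  by move=> c c' /(fpt_translate_local vmN) ->.
rewrite -expect_fpt (@expect_relabel (translate v) (grid (level m)) (fun c => (fpt c m)%:R)) //.
- exact: translate_inj.
- exact: uniq_grid.
- by move=> c c' /(fpt_local (leqnn _)) ->.
Qed.

Lemma mean_ge0 m : 0 <= mean_fpt w m.
Proof.
rewrite (mean_avg (leqnn _)) -[leLHS](avg_cst s (grid (level m)) 0 none).
by apply: (avg_le s_ge0 s_le1).
Qed.

Lemma mean_le_level m : mean_fpt w m <= (level m)%:R.
Proof.
rewrite (mean_avg (leqnn _)) -[leRHS](avg_cst s (grid (level m)) _ none).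
by apply: (avg_le s_ge0 s_le1) => // c _; rewrite ler_nat fpt_le_level.
Qed.

Lemma mean_subadd v m : mean_fpt w (translate v m) <= mean_fpt w v + mean_fpt w m.
Proof.
pose N := (level v + level m)%N.
rewrite (@mean_avg _ N) ?level_translate// (@mean_avg v N) ?leq_addr//.
rewrite (@mean_avg_translate v m N)// -avgD; apply: (avg_le s_ge0 s_le1) => // c _.
by rewrite -natrD ler_nat fpt_subadd.
Qed.

Lemma mean_swap m : mean_fpt w (swap m) = mean_fpt w m.
Proof.
rewrite -!expect_fpt -(@expect_relabel swap (grid (level m)) (fun c => (fpt c m)%:R)) //.
- by congr expect; apply/funext => c; rewrite fpt_swap.
- exact: can_inj swapK.
- exact: uniq_grid.
- by move=> c c' /(fpt_local (leqnn _)) ->.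
Qed.

(** Bounded differences over the [L] antidiagonals, with the optimal parameter
lam = t / (2 L); the bound on [t] ensures lam <= 1/3. *)
Lemma deviation_prob (t : R) m L : (level m <= L)%N -> (0 < L)%N ->
  0 <= t <= 2 * L%:R / 3 ->
  (P (event w (deviates w t m)) <= (2 * expR (- (t ^+ 2 / (4 * L%:R))))%:E)%E.
Proof.
move=> mL L0 /andP[t0 tL].
have Lgt0 : 0 < L%:R :> R by rewrite ltr0n.
rewrite [leLHS](@probability_event _ _ _ _ _ _ _ w_indep w_bern (grid L) _ none);
  [|exact: uniq_grid|exact: deviates_local].
rewrite lee_fin.
pose f (c : vertex -> bool) : R := (fpt c m)%:R.
pose lam : R := t / (2 * L%:R).
have lam0 : 0 <= lam <= 1 / 3.
  by rewrite /lam divr_ge0 ?mulr_ge0//= ler_pdivrMr ?mulr_gt0//; lra.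
have fL : {in antidiags L, forall D, forall c c', agree_off D c c' -> f c <= f c' + 1}.
  move=> D /mapP[i _ ->] c c' cc'; rewrite /f natr1 ler_nat.
  by rewrite -addn1; exact: fpt_antidiag_lip cc'.
have sizeL : size (antidiags L) = L by rewrite size_map size_iota.
have tail (sgn : R) : sgn ^+ 2 = 1 ->
    avg s (grid L) (fun c => (t <= sgn * (f c - mean_fpt w m))%R%:R) none
    <= expR (- (t ^+ 2 / (4 * L%:R))).
  move=> sgn1; have := avg_tail s_ge0 s_le1 t none sgn1 lam0 fL.
  rewrite -/(grid L) -(mean_avg mL) sizeL => h.
  rewrite (le_trans h)// ler_expR /lam le_eqVlt; apply/orP; left; apply/eqP.
  by field; rewrite gt_eqF.
apply: (@le_trans _ _ (avg s (grid L) (fun c =>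
   (t <= 1 * (f c - mean_fpt w m))%R%:R + (t <= -1 * (f c - mean_fpt w m))%R%:R) none)).
  apply: (avg_le s_ge0 s_le1) => // c _; rewrite /deviates -/(f c) mul1r mulN1r.
  case: (lerP 0 (f c - mean_fpt w m)) => h; rewrite ?(ger0_norm h) ?(ltr0_norm h).
    by rewrite lerDl ler0n.
  by rewrite lerDr ler0n.
rewrite avgD mulr_natl mulr2n lerD// tail ?expr1n//.
by rewrite sqrrN expr1n.
Qed.

Lemma atypical_prob (t : R) u : (0 < level u)%N ->
  0 <= t <= 2 * (level u)%:R / 3 ->
  (P (event w (atypical w t u)) <=
    (4 * ((level u).+1%:R) ^+ 2 * expR (- (t ^+ 2 / (4 * (level u)%:R))))%:E)%E.
Proof.
move=> u0 tu; pose e := expR (- (t ^+ 2 / (4 * (level u)%:R))).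
have dl v : v \in box u -> local_to (grid (level u)) (deviates w t v).
  by move=> /box_level vu; apply: deviates_local; lia.
have dl' v : v \in box u ->
    local_to (grid (level u)) (fun c => deviates w t (rest u v) (c \o translate v)).
  move=> /box_level vu c c' cc'; rewrite /deviates.
  by have -> // := @fpt_translate_local v (rest u v) (level u) _ c c' cc'; rewrite vu.
have step v : v \in box u -> (P (event w (fun c =>
    deviates w t v c || deviates w t (rest u v) (c \o translate v))) <= (4 * e)%:E)%E.
  move=> vu; have vu' := box_level vu.
  have -> : event w (fun c => deviates w t v c || deviates w t (rest u v) (c \o translate v)) =
     event w (deviates w t v) `|` event w (fun c => deviates w t (rest u v) (c \o translate v)).
    by apply/seteqP; split => om /= /orP.
  apply: (le_trans (measureU2 _ _ _)).
  - exact: measurable_event (dl _ vu).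
  - exact: measurable_event (dl' _ vu).
  have -> : 4 * e = 2 * e + 2 * e by ring.
  rewrite EFinD; apply: leeD; first by apply: deviation_prob => //; lia.
  rewrite [leLHS](@probability_relabel (translate v) (grid (level u)) (deviates w t (rest u v))).
  - by apply: deviation_prob => //; lia.
  - exact: translate_inj.
  - exact: uniq_grid.
  - by apply: deviates_local; lia.
apply: (le_trans (union_bound (N := level u) _ step)).
  by move=> v vu c c' cc'; rewrite (dl _ vu _ _ cc') (dl' _ vu _ _ cc').
rewrite lee_fin mulrA [leLHS]mulrC [leRHS]mulrC ler_wpM2l ?expR_ge0// mulrC.
rewrite ler_wpM2l// size_allpairs !size_iota -natrX ler_nat /level.
by rewrite -mulnn leq_mul//; lia.
Qed.

(** An inequality between means follows from the existence of a single typical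
configuration, in which the geodesic to [u] is cut at level [i]. *)
Lemma mean_superadd (t : R) u i :
  4 * ((level u).+1%:R) ^+ 2 * expR (- (t ^+ 2 / (4 * (level u)%:R))) < 1 ->
  (0 < level u)%N -> 0 <= t <= 2 * (level u)%:R / 3 -> (i <= level u)%N ->
  exists v m, [/\ u = translate v m, level v = i &
    mean_fpt w v + mean_fpt w m <= mean_fpt w u + 3 * t].
Proof.
move=> small u0 tu iu.
have [c /negP typ] : exists c, ~ atypical w t u c.
  apply: contrapT => /forallNP allat.
  have := atypical_prob u0 tu.
  have -> : event w (atypical w t u) = setT.
    by apply/seteqP; split => // om _; apply: contrapT => /allat.
  by rewrite probability_setT lee_fin leNgt small.
have [v [m [um vi h]]] := fpt_cross c iu; exists v, m; split => //.
have [h1 h2] := typicalP typ um.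
have [h3 _] := typicalP typ (v := u) (m := origin) (esym (translate0 u)).
move: h; rewrite -(ler_nat R) natrD => h.
move: h1 h2 h3; rewrite !ltr_norml => /andP[? ?] /andP[? ?] /andP[? ?]; lra.
Qed.

End Concentration.

(** * Existence and homogeneity of the shape function *)

Section Fekete.
Variable R : realType.
Implicit Types (a : nat -> R) (n : nat).

Lemma subadd_mul a q m r : (forall m n, a (m + n)%N <= a m + a n) ->
  a (q * m + r)%N <= q%:R * a m + a r.
Proof.
move=> suba; elim: q => [|q IH]; first by rewrite mul0n mul0r !add0r.
rewrite mulSn -addnA (le_trans (suba _ _))// -nat1r mulrDl mul1r -addrA.
by rewrite lerD2l.
Qed.

(** Fekete's lemma: writing n = q m + r with m almost optimal,
a n / n <= a m / m + O(1 / n). *)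
Lemma fekete a : (forall n, 0 <= a n) -> (forall m n, a (m + n)%N <= a m + a n) ->
  exists2 l : R, (fun n => a n / n%:R) @ \oo --> l &
    forall n, (0 < n)%N -> l <= a n / n%:R.
Proof.
move=> a0 suba.
pose A := [set a n / n%:R | n in [set n | (0 < n)%N]].
have hA : has_inf A.
  split; first by exists (a 1%N / 1%:R), 1%N.
  by exists 0 => _ [n _ <-]; rewrite divr_ge0.
pose l := inf A.
have l_le n : (0 < n)%N -> l <= a n / n%:R.
  by move=> n0; apply: (ge_inf hA.2); exists n.
exists l => //; apply/cvgrPdist_le => /= e e0.
have e20 : 0 < e / 2 by rewrite divr_gt0.
have [_ [m m0 <-] am] := inf_adherent e20 hA.
pose M := \sum_(r < m) a r.
have M0 : 0 <= M by apply: sumr_ge0.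
near=> n.
have n0 : (0 < n)%N by near: n; exact: nbhs_infty_gt.
have nR : 0 < n%:R :> R by rewrite ltr0n.
rewrite ler_norml; apply/andP; split; last first.
  by rewrite (@le_trans _ _ 0) ?subr_le0 ?l_le// ltW.
have Mn : M / n%:R <= e / 2.
  rewrite ler_pdivrMr// mulrC -ler_pdivrMr//.
  near: n; exact: nbhs_infty_ger.
have : a n / n%:R <= a m / m%:R + M / n%:R.
  rewrite {1}(divn_eq n m).
  apply: (@le_trans _ _ (((n %/ m)%:R * a m + a (n %% m)%N) / n%:R)).
    by rewrite ler_pM2r ?invr_gt0// subadd_mul.
  rewrite mulrDl lerD//.
    have mR : 0 < m%:R :> R by rewrite ltr0n.
    rewrite ler_pdivrMr// mulrAC ler_pdivlMr// mulrAC mulrC -natrM.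
    by rewrite ler_wpM2l// ler_nat leq_divM.
  rewrite ler_pM2r ?invr_gt0// /M.
  rewrite (bigD1 (Ordinal (ltn_pmod n m0)))//= lerDl.
  exact: sumr_ge0.
move: am; rewrite -/l; lra.
Unshelve. all: by end_near. Qed.

End Fekete.

Section Shape.
Variables (R : realType) (tau : vertex -> R).
Hypotheses (tau_ge0 : forall m, 0 <= tau m)
  (tau_le : forall m, tau m <= (level m)%:R)
  (tau_subadd : forall v m, tau (translate v m) <= tau v + tau m)
  (tau_swap : forall m, tau (swap m) = tau m).
Implicit Types (z : R * R).

Definition floor_pair z : vertex := (Num.truncn z.1, Num.truncn z.2).

(** Rounding down a sum of two points loses at most 1 in each coordinate, which
costs at most 2 in passage time. Adding 2 makes the rounded means exactly
subadditive over the real quadrant. *)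
Definition padded_tau z : R := tau (floor_pair z) + 2.

Definition quadrant z := 0 <= z.1 /\ 0 <= z.2.

Definition shape z : R :=
  limn (fun n => tau (Num.truncn (n%:R * z.1), Num.truncn (n%:R * z.2)) / n%:R : R).

Lemma truncnD_bounds (x y : R) : 0 <= x -> 0 <= y ->
  (Num.truncn x + Num.truncn y <= Num.truncn (x + y) <=
   Num.truncn x + Num.truncn y + 1)%N.
Proof.
move=> x0 y0.
have /andP[x1 x2] := truncn_itv x0; have /andP[y1 y2] := truncn_itv y0.
rewrite truncn_ge_nat ?addr_ge0// natrD lerD//=.
rewrite -ltnS truncn_lt_nat ?addr_ge0// -natr1 natrD.
move: x2 y2; rewrite -!natr1 => x2 y2; rewrite natrD; lra.
Qed.

Lemma padded_tau_ge0 z : 0 <= padded_tau z.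
Proof. by rewrite /padded_tau addr_ge0. Qed.

Lemma padded_tau_le z : quadrant z -> padded_tau z <= z.1 + z.2 + 2.
Proof.
move=> [z1 z2]; rewrite lerD2r (le_trans (tau_le _))// /level natrD.
by rewrite lerD// truncn_le.
Qed.

Lemma padded_tau_subadd z z' : quadrant z -> quadrant z' ->
  padded_tau (z + z') <= padded_tau z + padded_tau z'.
Proof.
move=> [z1 z2] [z1' z2'].
have /andP[a1 a2] := truncnD_bounds z1 z1'.
have /andP[b1 b2] := truncnD_bounds z2 z2'.
set u := floor_pair z; set u' := floor_pair z'.
pose v : vertex := (Num.truncn (z.1 + z'.1) - (u.1 + u'.1),
  Num.truncn (z.2 + z'.2) - (u.2 + u'.2))%N.
have -> : padded_tau (z + z') = tau (translate (translate u u') v) + 2.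
  rewrite /padded_tau; congr (tau _ + _); rewrite /floor_pair /translate /=.
  by congr (_, _); rewrite subnKC.
have lv : (level v)%:R <= 2 :> R.
  by rewrite ler_nat /level /v /=; lia.
have := tau_subadd (translate u u') v; have := tau_subadd u u'.
have := tau_le v; rewrite /padded_tau -/u -/u'; lra.
Qed.

Lemma quadrantZ x z : 0 <= x -> quadrant z -> quadrant (x *: z).
Proof. by move=> x0 [z1 z2]; split; rewrite mulr_ge0. Qed.

Lemma quadrantD z z' : quadrant z -> quadrant z' -> quadrant (z + z').
Proof. by move=> [? ?] [? ?]; split; rewrite addr_ge0. Qed.

Lemma shape_fekete z : quadrant z ->
  (fun n => padded_tau (n%:R *: z) / n%:R) @ \oo --> shape z /\
  forall n, (0 < n)%N -> shape z <= padded_tau (n%:R *: z) / n%:R.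
Proof.
move=> qz; have [|m n|l cl ll] := @fekete R (fun n => padded_tau (n%:R *: z)).
- by move=> n; exact: padded_tau_ge0.
- by rewrite natrD scalerDl; apply: padded_tau_subadd; exact: quadrantZ.
suff -> : shape z = l by [].
apply/cvg_lim => //.
have : (fun n : nat => padded_tau (n%:R *: z) / n%:R - 2 * n%:R^-1 : R) @ \oo --> l - 2 * 0.
  apply: cvgB => //; apply: cvgM; first exact: cvg_cst.
  rewrite -(cvg_shiftS (fun n : nat => n%:R^-1 : R)); exact: cvg_harmonic.
rewrite mulr0 subr0; apply: cvg_trans; apply: near_eq_cvg; near=> n.
by rewrite /padded_tau mulrDl addrK.
Unshelve. all: by end_near. Qed.

Lemma shape_le_padded_tau z : quadrant z -> shape z <= padded_tau z.
Proof. by move=> /shape_fekete[_ /(_ 1%N isT)]; rewrite scale1r divr1. Qed.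

(** The convergence to the shape function holds along real multiples, which is
what homogeneity requires. *)
Lemma padded_tau_le_shape z (e : R) : quadrant z -> 0 < e ->
  exists2 X : R, 0 < X & forall x, X <= x -> padded_tau (x *: z) <= x * (shape z + e).
Proof.
move=> qz e0; have [cz lz] := shape_fekete qz.
have e20 : 0 < e / 2 by rewrite divr_gt0.
move/cvgrPdist_le : cz => /(_ _ e20) [N _ HN].
have g0 : - (e / 2) <= shape z.
  have := HN N (leqnn N); rewrite ler_norml => /andP[h _].
  by apply: (le_trans h); rewrite lerBlDr lerDl divr_ge0// padded_tau_ge0.
pose C := z.1 + z.2 + 2; have C0 : 0 < C by rewrite /C; case: qz; lra.
pose X : R := N.+1%:R + C / (e / 2); exists X.
  by rewrite ltr_wpDr ?ltr0n// divr_ge0// ltW.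
move=> x Xx.
have Ce : 0 <= C / (e / 2) by rewrite divr_ge0// ltW.
have x0 : 0 <= x by rewrite (le_trans _ Xx)// addr_ge0.
pose n := Num.truncn x; have /andP[n1 n2] := truncn_itv x0.
rewrite -/n in n1 n2.
have Nn : (N < n)%N.
  by rewrite truncn_gt_nat (le_trans _ Xx)// lerDl.
have -> : x *: z = n%:R *: z + (x - n%:R) *: z by rewrite -scalerDl addrC subrK.
have qn : quadrant (n%:R *: z) by exact: quadrantZ.
have xn0 : 0 <= x - n%:R by rewrite subr_ge0.
have qx : quadrant ((x - n%:R) *: z) by exact: quadrantZ.
apply: (le_trans (padded_tau_subadd qn qx)).
have h1 : padded_tau ((x - n%:R) *: z) <= C.
  apply: (le_trans (padded_tau_le qx)); rewrite /C lerD2r.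
  case: qz => z1 z2; move: n2; rewrite -natr1 => n2.
  by rewrite lerD// ler_piMl//; lra.
have nR : 0 < n%:R :> R by rewrite ltr0n (leq_ltn_trans _ Nn).
have h2 : padded_tau (n%:R *: z) <= n%:R * (shape z + e / 2).
  have := HN n (ltnW Nn); rewrite ler_norml => /andP[h _].
  rewrite mulrC -ler_pdivrMr//; move: h => /=; lra.
have h3 : C <= x * (e / 2).
  by rewrite -ler_pdivrMr//; apply: le_trans Xx; rewrite lerDr ler0n.
have h4 : n%:R * (shape z + e / 2) <= x * (shape z + e / 2).
  by rewrite ler_wpM2r//; lra.
lra.
Qed.

Lemma shape_subadd z z' : quadrant z -> quadrant z' ->
  shape (z + z') <= shape z + shape z'.
Proof.
move=> qz qz'; apply/ler_addgt0Pr => e e0.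
have e20 : 0 < e / 2 by rewrite divr_gt0.
have [X X0 HX] := padded_tau_le_shape qz e20.
have [X' X0' HX'] := padded_tau_le_shape qz' e20.
pose n := (Num.truncn (X + X')).+1.
have nX : X + X' <= n%:R by apply: ltW; rewrite /n truncnS_gt.
have := (shape_fekete (quadrantD qz qz')).2 n (ltn0Sn _).
rewrite ler_pdivlMr ?ltr0n// => h.
have nR : 0 < n%:R :> R by rewrite ltr0n.
rewrite -(ler_pM2r nR); apply: (le_trans h).
rewrite scalerDr (le_trans (padded_tau_subadd _ _)) //; [exact: quadrantZ|exact: quadrantZ|].
have := HX n%:R ltac:(lra); have := HX' n%:R ltac:(lra); lra.
Qed.

Lemma shape_scale_le (x : R) z : 0 < x -> quadrant z -> shape (x *: z) <= x * shape z.
Proof.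
move=> x0 qz; apply/ler_addgt0Pr => e e0.
have ex0 : 0 < e / x by rewrite divr_gt0.
have [X X0 HX] := padded_tau_le_shape qz ex0.
pose n := (Num.truncn (X / x)).+1.
have nX : X / x <= n%:R by apply: ltW; rewrite /n truncnS_gt.
have := (shape_fekete (quadrantZ (ltW x0) qz)).2 n (ltn0Sn _).
rewrite ler_pdivlMr ?ltr0n// scalerA => h.
have nR : 0 < n%:R :> R by rewrite ltr0n.
rewrite -(ler_pM2r nR); apply: (le_trans h).
rewrite ler_pdivrMr// in nX; apply: (le_trans (HX _ nX)).
have -> : n%:R * x * (shape z + e / x) = (x * shape z + e) * n%:R.
  by field; rewrite gt_eqF.
exact: lexx.
Qed.

Lemma shape_scale (x : R) z : 0 < x -> quadrant z -> shape (x *: z) = x * shape z.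
Proof.
move=> x0 qz; apply/eqP; rewrite eq_le shape_scale_le//=.
have ix0 : 0 < x^-1 by rewrite invr_gt0.
have := shape_scale_le ix0 (quadrantZ (ltW x0) qz).
rewrite scalerA mulVf ?gt_eqF// scale1r.
by rewrite mulrC ler_pdivlMr// mulrC.
Qed.

Lemma shape_swap (x y : R) : shape (x, y) = shape (y, x).
Proof. by rewrite /shape /=; congr (limn _); apply/funext => n; rewrite -tau_swap. Qed.

End Shape.

(** * Curvature of the shape function at the diagonal *)

Section DifferentiableCriterion.
Variables (R : realType) (V : normedModType R).

Lemma differentiable_linear_approx (f : V -> R) x (df : {linear V -> R}) :
  continuous df ->
  (forall e : R, 0 < e ->
     \forall y \near (0 : V), `|f (y + x) - (f x + df y)| <= e * `|y|) ->
  differentiable f x.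
Proof.
move=> cdf approx.
have E : f \o shift x = cst (f x) + df +o_ (0 : V) id.
  by apply/eqaddoP => e e0; exact: approx.
by apply/diff_locallyP; rewrite (diff_unique cdf E); split.
Qed.

End DifferentiableCriterion.

Section SumForm.
Variables (R : realType) (a : R).

(** The differential of the shape function at (1,1), when it exists: by symmetry
and homogeneity it is a multiple of the sum of the coordinates. *)
Definition sum_form (z : R * R) : R := a * (z.1 + z.2).

Lemma sum_form_linear : linear sum_form.
Proof. by move=> k x y; rewrite /sum_form /= /GRing.scale /=; ring. Qed.

HB.instance Definition _ := GRing.isLinear.Build R (R * R)%type R _ sum_form
  sum_form_linear.

Lemma continuous_sum_form : continuous sum_form.
Proof.
move=> z; apply: cvgM; first exact: cvg_cst.
by apply: cvgD; [exact: cvg_fst|exact: cvg_snd].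
Qed.

End SumForm.

Section Curvature.
Variables (R : realType) (tau : vertex -> R).
Hypotheses (tau_ge0 : forall m, 0 <= tau m)
  (tau_le : forall m, tau m <= (level m)%:R)
  (tau_subadd : forall v m, tau (translate v m) <= tau v + tau m)
  (tau_swap : forall m, tau (swap m) = tau m).

Let g : R * R -> R := shape tau.
Let gD := shape_subadd tau_ge0 tau_le tau_subadd.
Let gZ := shape_scale tau_ge0 tau_le tau_subadd.

Definition bend (q : R) : R := shape tau (1 - q, 1 + q) - shape tau (1, 1).

Let quad (q : R) : `|q| <= 1 -> @quadrant R (1 - q, 1 + q).
Proof. by rewrite ler_norml => /andP[? ?]; split => /=; lra. Qed.

Let quad11 : @quadrant R (1, 1). Proof. by split => /=. Qed.

Let pairZ (a x y : R) : a *: ((x, y) : R * R) = (a * x, a * y). Proof. by []. Qed.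

Let pairD (x y x' y' : R) : ((x, y) + (x', y') : R * R) = (x + x', y + y').
Proof. by []. Qed.

Lemma bendN q : bend (- q) = bend q.
Proof. by rewrite /bend opprK (shape_swap tau_swap). Qed.

Lemma bend_norm q : bend `|q| = bend q.
Proof.
by have [q0|q0] := lerP 0 q; [rewrite ger0_norm|rewrite ltr0_norm// bendN].
Qed.

(** The midpoint of (1 - q, 1 + q) and its mirror image is (1, 1). *)
Lemma bend_ge0 q : `|q| <= 1 -> 0 <= bend q.
Proof.
move=> q1; have qm : `|- q| <= 1 by rewrite normrN.
have := gD (quad q1) (quad qm).
have -> : ((1 - q, 1 + q) + (1 - - q, 1 + - q) : R * R) = 2 *: (1, 1).
  by rewrite ?pairZ ?pairD; congr (_, _); ring.
rewrite gZ //; have := bendN q; rewrite /bend; lra.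
Qed.

Lemma bend_scale t q : 0 <= t <= 1 -> `|q| <= 1 -> bend (t * q) <= t * bend q.
Proof.
move=> /andP[t0 t1] q1.
have [->|tn0] := eqVneq t 0; first by rewrite !mul0r /bend subr0 addr0 subrr.
have [->|tn1] := eqVneq t 1; first by rewrite !mul1r.
have tp : 0 < t by rewrite lt_neqAle eq_sym tn0.
have tp1 : 0 < 1 - t by rewrite subr_gt0 lt_neqAle tn1.
have := gD (quadrantZ (ltW tp) (quad q1)) (quadrantZ (ltW tp1) quad11).
have -> : (t *: (1 - q, 1 + q) + (1 - t) *: (1, 1) : R * R) = (1 - t * q, 1 + t * q).
  by rewrite ?pairZ ?pairD; congr (_, _); ring.
by rewrite (gZ tp (quad q1)) (gZ tp1 quad11) /bend; lra.
Qed.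

Lemma shape_bend (x y : R) : 0 <= x -> 0 <= y -> 0 < x + y ->
  shape tau (x, y) = (x + y) / 2 * (shape tau (1, 1) + bend ((y - x) / (x + y))).
Proof.
move=> x0 y0 xy; rewrite /bend (addrC (shape tau (1, 1))) subrK -gZ ?divr_gt0//; last first.
  by apply: quad; rewrite normrM (gtr0_norm (x := (x + y)^-1)) ?invr_gt0// ler_pdivrMr// ler_norml; lra.
rewrite pairZ.
have -> : (x + y) / 2 * (1 - (y - x) / (x + y)) = x by field; rewrite gt_eqF.
by have -> : (x + y) / 2 * (1 + (y - x) / (x + y)) = y by field; rewrite gt_eqF.
Qed.

(** Scaling down a point where bend q < c |q| gives the same inequality on a
neighbourhood of 0; with c arbitrary, bend is o(q), and by homogeneity the
shape function is sum_form up to o(z). *)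
Lemma differentiable_flat :
  (forall c : R, 0 < c -> exists2 q, `|q| <= 1 & bend q < c * `|q|) ->
  differentiable g ((1, 1) : R * R).
Proof.
move=> flat; apply: (@differentiable_linear_approx _ _ g (1, 1) (sum_form (g (1, 1) / 2))).
  exact: continuous_sum_form.
move=> e e0; have [q q1 qe] := flat e e0.
have q0 : 0 < `|q|.
  rewrite lt_neqAle normr_ge0 andbT eq_sym; apply: contraTneq qe => ->.
  by rewrite mulr0 -leNgt bend_ge0.
apply/nbhs_norm0P; exists (`|q| / 4) => [|z /= zq]; first by rewrite /= divr_gt0.
have [z1 z2] : `|z.1| <= `|z| /\ `|z.2| <= `|z|.
  by rewrite /Num.norm /= !le_max !lexx orbT.
have : `|z| < 1 / 4 by lra.
set x := 1 + z.1; set y := 1 + z.2 => z4.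
have /andP[z1a z1b] : - `|z| <= z.1 <= `|z| by rewrite -ler_norml.
have /andP[z2a z2b] : - `|z| <= z.2 <= `|z| by rewrite -ler_norml.
have xy : 0 < x + y by rewrite /x /y; lra.
have -> : g (z + (1, 1)) = (x + y) / 2 * (g (1, 1) + bend ((y - x) / (x + y))).
  have -> : z + (1, 1) = (x, y) by rewrite addrC.
  by apply: shape_bend => //; rewrite /x /y; lra.
set p := (y - x) / (x + y).
have pE : `|p| = `|z.2 - z.1| / (x + y).
  rewrite /p normrM (gtr0_norm (x := (x + y)^-1)) ?invr_gt0//.
  by congr (`|_| / _); rewrite /x /y; ring.
have pz : `|z.2 - z.1| <= 2 * `|z|.
  by rewrite ler_norml; lra.
have pq : `|p| <= `|q|.
  by rewrite pE ler_pdivrMr// (le_trans pz)// /x /y; nra.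
have bp : bend p <= e * `|p|.
  rewrite -bend_norm.
  have -> : `|p| = (`|p| / `|q|) * `|q| by rewrite divfK ?gt_eqF.
  have t01 : 0 <= `|p| / `|q| <= 1 by rewrite divr_ge0//= ler_pdivrMr// mul1r.
  apply: (le_trans (bend_scale t01 _)); first by rewrite normr_id.
  rewrite bend_norm mulrCA; case/andP: t01 => t0 _.
  by rewrite ler_wpM2l// ltW.
have -> : (x + y) / 2 * (g (1, 1) + bend p) - (g (1, 1) + sum_form (g (1, 1) / 2) z)
   = (x + y) / 2 * bend p.
  by rewrite /sum_form /x /y; field.
rewrite ger0_norm; last by rewrite mulr_ge0 ?divr_ge0 ?(ltW xy)// bend_ge0// (le_trans pq).
apply: (@le_trans _ _ ((x + y) / 2 * (e * `|p|))).
  by rewrite ler_wpM2l// divr_ge0// ltW.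
have -> : (x + y) / 2 * (e * `|p|) = e * (`|z.2 - z.1| / 2).
  by rewrite pE; field; rewrite gt_eqF.
by rewrite ler_wpM2l ?(ltW e0)// ler_pdivrMr// mulrC.
Qed.

(** The curvature assumption bounds bend below near 0 only, and convexity extends
the bound to [-1, 1]. In the non-differentiable case k = 1, and failure of every
linear bound would contradict non-differentiability by
[differentiable_flat]. *)
Lemma bend_ge_power (k : R) : 1 <= k -> curvature_power_at11 g k ->
  exists2 c : R, 0 < c & forall q, `|q| <= 1 -> c * `|q| `^ k <= bend q.
Proof.
move=> k1 [curv_diff curv_nondiff]; have k0 : 0 < k by lra.
have [gdiff|gnd] := pselect (differentiable g ((1, 1) : R * R)); last first.
  have -> := curv_nondiff gnd.
  apply: contrapT => noc; apply: gnd; apply: differentiable_flat => c c0.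
  apply: contrapT => noq; apply: noc; exists c => // q q1.
  rewrite powRr1// leNgt; apply/negP => lt; apply: noq; exists q => //.
have [delta [c [C' [d0 c0 C0 hc]]]] := curv_diff gdiff.
pose q0 := Num.min 1 (delta / 4).
have q00 : 0 < q0 by rewrite lt_min ltr01 divr_gt0.
have q01 : q0 <= 1 by rewrite ge_min lexx.
have q0d : q0 <= delta / 4 by rewrite ge_min lexx orbT.
have small q : `|q| <= q0 -> c * `|q| `^ k <= bend q.
  move=> qq; have q1 : `|q| <= 1 by lra.
  have en1 : `|q| <= enorm (- q, q).
    by rewrite /enorm /= sqrrN -sqrtr_sqr ler_wsqrtr// lerDl sqr_ge0.
  have en2 : enorm (- q, q) <= 2 * `|q|.
    rewrite /enorm /= sqrrN.
    have -> : 2 * `|q| = `|2 * `|q| | by rewrite [RHS]ger0_norm ?mulr_ge0.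
    rewrite -sqrtr_sqr ler_wsqrtr// exprMn real_normK ?num_real//.
    have := sqr_ge0 q; lra.
  have hz : (- q, q).1 * ((1, 1) : R * R).1 + (- q, q).2 * ((1, 1) : R * R).2 = 0.
    by rewrite /=; ring.
  have /andP[h _] := hc (- q, q) hz ltac:(lra).
  have -> : bend q = `|g ((1, 1) + (- q, q)) - g (1, 1)|.
    by rewrite ger0_norm //; exact: bend_ge0.
  apply: le_trans h; rewrite ler_wpM2l ?(ltW c0)// ge0_ler_powR ?nnegrE//; first lra.
  exact: sqrtr_ge0.
exists (c * q0 `^ k); first by rewrite mulr_gt0// powR_gt0.
move=> q q1; have pk0 : 0 <= q0 `^ k by exact: powR_ge0.
have powle1 (x : R) : 0 <= x <= 1 -> x `^ k <= 1.
  move=> /andP[x0 x1]; have -> : 1 = 1 `^ k :> R by rewrite powR1.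
  by rewrite ge0_ler_powR ?nnegrE// ltW.
have [qq|qq] := lerP `|q| q0.
  apply: le_trans (small q qq); rewrite -mulrA ler_wpM2l ?(ltW c0)//.
  by rewrite ler_piMl ?powR_ge0// powle1// (ltW q00).
have qp : 0 < `|q| by lra.
have t01 : 0 <= q0 / `|q| <= 1.
  by rewrite divr_ge0 ?(ltW q00)//= ler_pdivrMr// mul1r ltW.
have nq : `| `|q| | <= 1 by rewrite normr_id.
have := bend_scale t01 nq; rewrite divfK ?gt_eqF// bend_norm => h.
have := small q0; rewrite ger0_norm ?(ltW q00)// => /(_ (lexx _)) h2.
have b0 := bend_ge0 q1.
apply: (@le_trans _ _ (c * q0 `^ k)).
  by rewrite ler_piMr ?powle1 ?normr_ge0// mulr_ge0// ltW.
apply: (le_trans h2); apply: (le_trans h).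
by rewrite ler_piMl//; case/andP: t01.
Qed.

End Curvature.

(** * Error scales, nonrandom error and geodesics *)

Section Exponents.
Variables (R : realType) (k : R).
Hypothesis k_ge1 : 1 <= k.

(** Passage times deviate from their means by less than L^err_exp outside an event
of probability at most 2 exp(- L^prob_exp). Both exponents are dictated by
err_exp = 1 - k prob_exp, which turns an error n^err_exp into a displacement
n^(1 - prob_exp), and by 2 err_exp - 1 = 3 prob_exp > 0. *)
Definition err_exp : R := (k + 3) / (2 * k + 3).
Definition prob_exp : R := 1 / (2 * k + 3).

Lemma prob_exp_gt0 : 0 < prob_exp.
Proof. by have k1 := k_ge1; rewrite divr_gt0//; lra. Qed.

Lemma err_exp_gt0 : 0 < err_exp.
Proof. by have k1 := k_ge1; rewrite divr_gt0//; lra. Qed.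

Lemma err_expE : err_exp = 1 - k * prob_exp.
Proof. by have k1 := k_ge1; rewrite /err_exp /prob_exp; field; lra. Qed.

Lemma err_exp_lt1 : err_exp < 1.
Proof. by have k1 := k_ge1; rewrite err_expE gtrBl mulr_gt0 ?prob_exp_gt0//; lra. Qed.

Lemma powR_expR (x p : R) : 0 < x -> x `^ p = expR (p * ln x).
Proof. by move=> x0; rewrite /powR gt_eqF. Qed.

(** With y = L^prob_exp, the exponent t^2 / (4 L) is y^3 / 4, while the logarithm
of the polynomial prefactor is O(y / prob_exp); [Y] is a value of y above which
the cubic term wins. *)
Lemma err_scale_eventually : exists2 L0 : nat, (3 <= L0)%N & forall L : nat, (L0 <= L)%N ->
  let t := L%:R `^ err_exp in
  [/\ 0 <= t <= 2 * L%:R / 3,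
      4 * (L.+1%:R) ^+ 2 * expR (- (t ^+ 2 / (4 * L%:R))) <=
        2 * expR (- (L%:R `^ prob_exp)) &
      2 * expR (- (L%:R `^ prob_exp)) < 1].
Proof.
have k1 := k_ge1; have a0 := prob_exp_gt0; set a := prob_exp in a0 *; set b := err_exp.
pose Y : R := 4 * (5 / a + 1).
have Y4 : 4 <= Y by rewrite /Y ler_peMr// lerDr divr_ge0// ltW.
exists (Num.truncn (Y `^ a^-1) + 3)%N; first by rewrite leq_addl.
move=> L LL0 t.
have L3 : (3 <= L)%N by apply: leq_trans LL0; rewrite leq_addl.
have L3R : 3 <= L%:R :> R by rewrite ler_nat.
have Lp : 0 < L%:R :> R by lra.
set l := ln (L%:R : R).
have LE : L%:R = expR l :> R by rewrite lnK.
have l0 : 0 <= l by apply: ln_ge0; lra.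
pose y : R := expR (a * l).
have yE : L%:R `^ a = y by rewrite powR_expR.
have tE : t = expR (b * l) by rewrite /t powR_expR.
have yY : Y <= y.
  rewrite -yE; have -> : Y = (Y `^ a^-1) `^ a.
    by rewrite -powRrM mulVf ?gt_eqF// powRr1//; lra.
  apply: ge0_ler_powR; rewrite ?nnegrE ?powR_ge0 ?ltW//.
  have := truncnS_gt (Y `^ a^-1) => h; apply: (lt_trans h).
  by rewrite ltr_nat (leq_trans _ LL0) // addn3.
have ly : l <= y / a.
  by rewrite ler_pdivlMr// (le_trans _ (expR_ge1Dx (a * l)))// mulrC lerDr.
have y0 : 0 < y by exact: expR_gt0.
have tL : L%:R = t * expR (k * a * l).
  by rewrite LE tE -expRD; congr expR; rewrite /b err_expE -/a; ring.
have ky : y <= expR (k * a * l).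
  by rewrite ler_expR -mulrA ler_peMl// mulr_ge0// ltW.
have t0 : 0 <= t by exact: powR_ge0.
have tY : t * 4 <= L%:R.
  by rewrite tL ler_wpM2l//; lra.
have expE : t ^+ 2 / (4 * L%:R) = y ^+ 3 / 4.
  have t2 : t ^+ 2 = L%:R * y ^+ 3.
    rewrite LE tE /y -!expRM_natl -expRD; congr expR.
    by rewrite /b /a /err_exp /prob_exp; field; lra.
  by rewrite t2; field; rewrite gt_eqF.
rewrite yE expE; split.
- by rewrite t0 /=; lra.
- apply: (@le_trans _ _ (2 * L%:R ^+ 5 * expR (- (y ^+ 3 / 4)))).
    rewrite ler_wpM2r ?expR_ge0// -natr1.
    have -> : 2 * L%:R ^+ 5 = L%:R ^+ 2 * (2 * L%:R ^+ 3) :> R by ring.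
    have h3 : 27 <= L%:R ^+ 3 :> R.
      have -> : 27 = 3 ^+ 3 :> R by ring.
      by rewrite lerXn2r ?nnegrE; lra.
    have h2 : 0 <= L%:R ^+ 2 :> R by exact: sqr_ge0.
    nra.
  rewrite -mulrA ler_wpM2l// LE -expRM_natl -expRD ler_expR.
  have h : 5 * l + y <= y ^+ 3 / 4.
    apply: (@le_trans _ _ (y * (5 / a + 1))).
      have -> : y * (5 / a + 1) = 5 * (y / a) + y by ring.
      by rewrite lerD2r ler_wpM2l.
    have -> : y ^+ 3 / 4 = y * (y ^+ 2 / 4) by field.
    rewrite ler_wpM2l ?(ltW y0)//.
    have : y <= y ^+ 2 by rewrite expr2 ler_peMl; lra.
    by move: yY; rewrite /Y; lra.
  lra.
- rewrite expRN; have := expR_ge1Dx y => h.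
  by rewrite ltr_pdivrMr ?mul1r ?expR_gt0//; lra.
Qed.

End Exponents.

Section Geodesics.
Variables (R : realType) (d : measure_display) (Om : measurableType d).
Variables (P : probability Om R) (s : R) (w : vertex -> {RV P >-> bool}) (k : R).
Hypotheses (s_gt0 : 0 < s) (s_lt1 : s < 1) (w_iid : iid_bernoulli s w)
  (k_ge1 : 1 <= k).

Let tau := mean_fpt w.
Let tau_ge0 := mean_ge0 s_gt0 s_lt1 w_iid.
Let tau_le := mean_le_level s_gt0 s_lt1 w_iid.
Let tau_subadd := mean_subadd s_gt0 s_lt1 w_iid.
Let tau_swap := mean_swap w_iid.
Let gamma := shape tau (1, 1).
Let b := err_exp k.

Lemma padded_tau_nat (x y : nat) : padded_tau tau (x%:R, y%:R) = tau (x, y) + 2.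
Proof. by rewrite /padded_tau /floor_pair /= !natrK. Qed.

(** The number [K] of the proof solves 2 K = (K + 3) 2^b: adding K M^b to the
lower bound at level M absorbs the error 3 (2M)^b made when the level doubles. *)
Lemma mean_diag_le_shape : exists2 K : R, 0 <= K & exists N : nat, forall n : nat, (N <= n)%N ->
  tau (n, n) <= n%:R * gamma + K * n%:R `^ b.
Proof.
have [L0 L03 HL0] := err_scale_eventually k_ge1.
have b0 : 0 < b := err_exp_gt0 k_ge1; have b1 : b < 1 := err_exp_lt1 k_ge1.
have two : 2 `^ b < 2 :> R.
  rewrite powR_expR// -[ltRHS]lnK ?posrE// ltr_expR.
  by rewrite gtr_pMl // ln_gt0 // ltr1n.
pose K : R := 3 * 2 `^ b / (2 - 2 `^ b).
have K0 : 0 <= K.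
  by rewrite /K divr_ge0 ?mulr_ge0 ?powR_ge0//; lra.
have KE : 2 * K = (K + 3) * 2 `^ b by rewrite /K; field; lra.
exists (2 * K); first by rewrite mulr_ge0.
exists L0 => n nL0.
have n0 : (0 < n)%N by lia.
pose B : R := tau (n, n) / 2.
(* A vertex and its mirror image on the antidiagonal add up to (n, n). *)
have base v : level v = n -> B <= tau v.
  move=> vn; have := tau_subadd v (swap v); rewrite tau_swap -/tau.
  have -> : translate v (swap v) = (n, n).
    by rewrite -vn /translate /level /=; congr (_, _); rewrite addnC.
  rewrite /B; lra.
have grow j u : level u = (2 ^ j * n)%N ->
    2 ^+ j * (B - K * n%:R `^ b) + K * (2 ^ j * n)%:R `^ b <= tau u.
  elim: j u => [|j IH] u uj.
    by rewrite expr0 mul1r mul1n subrK base // uj mul1n.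
  pose M := (2 ^ j * n)%N.
  have uM : level u = (2 * M)%N by rewrite uj expnS mulnA.
  have MnN : (n <= M)%N by rewrite leq_pmull ?expn_gt0.
  have uL : (L0 <= level u)%N.
    by rewrite uM (leq_trans nL0) // (leq_trans MnN) // leq_pmull.
  have [tu p1 p2] := HL0 _ uL.
  have Mu : (M <= level u)%N by rewrite uM leq_pmull.
  have u0 : (0 < level u)%N by rewrite (leq_trans _ uL) // (leq_trans _ L03).
  have [v [m [um vM h]]] := mean_superadd s_gt0 s_lt1 w_iid (le_lt_trans p1 p2) u0 tu Mu.
  have mM : level m = M.
    apply/eqP; rewrite -(eqn_add2l (level v)) -level_translate -um uM vM.
    by rewrite mul2n addnn.
  have hv := IH v vM; have hm := IH m mM; rewrite -/M in hv hm.
  have powM : (level u)%:R `^ b = 2 `^ b * M%:R `^ b :> R.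
    by rewrite uM natrM powRM.
  rewrite -uj powM; move: h; rewrite -/tau powM exprS => h.
  have := KE; set T := M%:R `^ b in hv hm h *; set D := 2 `^ b in h * => KE'.
  have : 2 * K * T = (K + 3) * D * T by rewrite KE'.
  rewrite -(mulrA 2 (2 ^+ j)); move: hv hm h; set X := 2 ^+ j * _; lra.
(* [grow] applies to (N, N) with N = 2 ^ j n, and tau (N, N) / N tends to gamma. *)
have key : 2 * (B - K * n%:R `^ b) <= n%:R * gamma.
  apply/ler_addgt0Pr => e e0.
  have nR : 0 < n%:R :> R by rewrite ltr0n.
  have en0 : 0 < e / n%:R by rewrite divr_gt0.
  have q11 : @quadrant R (1, 1) by split => /=.
  have [X X0 HX] := padded_tau_le_shape tau_ge0 tau_le tau_subadd q11 en0.
  pose j := (Num.truncn X).+1; pose N := (2 ^ j * n)%N.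
  have XN : X <= N%:R.
    apply: (@le_trans _ _ j%:R); first by apply: ltW; exact: truncnS_gt.
    rewrite ler_nat /N (leq_trans (ltnW (ltn_expl j (ltnSn 1))))//.
    by rewrite leq_pmulr.
  have := HX _ XN.
  have -> : N%:R *: (1, 1) = (N%:R, N%:R) :> R * R.
    by rewrite -[LHS]/(N%:R * 1, N%:R * 1) mulr1.
  rewrite padded_tau_nat -/gamma => up.
  have NN : level (N, N) = (2 ^ j.+1 * n)%N.
    by rewrite /level /= addnn -mul2n /N mulnA -expnS.
  have := grow _ _ NN; set T := K * (2 ^ j.+1 * n)%:R `^ b => low.
  have T0 : 0 <= T by rewrite mulr_ge0 ?powR_ge0.
  have NE : N%:R = 2 ^+ j * n%:R :> R by rewrite natrM natrX.
  have j0 : 0 < 2 ^+ j :> R by rewrite exprn_gt0.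
  rewrite -(ler_pM2l j0).
  have : 2 ^+ j * (n%:R * gamma + e) = N%:R * (gamma + e / n%:R).
    by rewrite NE; field; rewrite gt_eqF.
  move=> ->; move: low up T0; rewrite exprS.
  set Z := 2 ^+ j; set W := B - _; set V := N%:R * (_ + _) => low up T0.
  have -> : Z * (2 * W) = 2 * Z * W by ring.
  lra.
move: key; rewrite /B; lra.
Qed.

Lemma mean_ge_diag v : (level v)%:R / 2 * gamma <= tau v + 2.
Proof.
case: v => x y; have [->|l0] := posnP (level (x, y)).
  by rewrite !mul0r addr_ge0 // tau_ge0.
have q : @quadrant R (x%:R, y%:R) by split => /=.
have xy : 0 < x%:R + y%:R :> R by rewrite -natrD ltr0n.
have xy1 : `|(y%:R - x%:R) / (x%:R + y%:R)| <= 1 :> R.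
  rewrite normrM (gtr0_norm (x := (x%:R + y%:R)^-1)) ?invr_gt0//.
  rewrite ler_pdivrMr// ler_norml; have := ler0n R x; have := ler0n R y; lra.
have := shape_le_padded_tau tau_ge0 tau_le tau_subadd q.
rewrite padded_tau_nat (shape_bend tau_ge0 tau_le tau_subadd) // => h.
have := bend_ge0 tau_ge0 tau_le tau_subadd tau_swap xy1 => hb.
by apply: le_trans h; rewrite /level /= natrD -/gamma ler_wpM2l ?lerDl.
Qed.

(** The curvature gain at level r is r (D / r)^k up to a factor; as k >= 1, it is
smallest for the largest level r = 2 n. *)
Lemma mean_ge_bend (c : R) (n : nat) v :
  0 < c -> (forall q, `|q| <= 1 -> c * `|q| `^ k <= bend tau q) ->
  (level v <= 2 * n)%N -> v.1 != v.2 ->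
  (level v)%:R / 2 * gamma +
    c * n%:R * (`|v.1%:R - v.2%:R| / (2 * n%:R)) `^ k <= tau v + 2.
Proof.
have k1 := k_ge1; case: v => x y c0 hc /=; rewrite /level /= => ln xy_neq.
set D := `|x%:R - y%:R|.
have D0 : 0 < D by rewrite normr_gt0 subr_eq0 eqr_nat.
have q : @quadrant R (x%:R, y%:R) by split => /=.
have xy : 0 < x%:R + y%:R :> R by rewrite -natrD ltr0n; lia.
have qE : `|(y%:R - x%:R) / (x%:R + y%:R)| = D / (x%:R + y%:R) :> R.
  by rewrite normrM (gtr0_norm (x := (x%:R + y%:R)^-1)) ?invr_gt0// distrC.
have xy1 : `|(y%:R - x%:R) / (x%:R + y%:R)| <= 1 :> R.
  rewrite qE ler_pdivrMr// /D ler_norml; have := ler0n R x; have := ler0n R y; lra.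
have := shape_le_padded_tau tau_ge0 tau_le tau_subadd q.
rewrite padded_tau_nat (shape_bend tau_ge0 tau_le tau_subadd) // => h.
apply: le_trans h; rewrite natrD -/gamma mulrDr lerD2l.
have hb := hc _ xy1; rewrite qE in hb.
set r := x%:R + y%:R in xy hb *.
have r2 : 0 < r / 2 by rewrite divr_gt0.
apply: le_trans (ler_wpM2l (ltW r2) hb).
have rn : r <= 2 * n%:R by rewrite /r -natrD -natrM ler_nat.
have n0 : 0 < n%:R :> R by lra.
have powk (z : R) : 0 < z -> z `^ k = z * z `^ (k - 1).
  by move=> z0; rewrite mulr_powRB1 ?(ltW z0)//; lra.
have Dr : 0 < D / r by rewrite divr_gt0.
have Dn : 0 < D / (2 * n%:R) by rewrite divr_gt0// mulr_gt0.
rewrite (powk _ Dr) (powk _ Dn).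
have -> : c * n%:R * (D / (2 * n%:R) * (D / (2 * n%:R)) `^ (k - 1)) =
   c * D / 2 * (D / (2 * n%:R)) `^ (k - 1) by field; rewrite gt_eqF.
have -> : r / 2 * (c * (D / r * (D / r) `^ (k - 1))) =
   c * D / 2 * (D / r) `^ (k - 1) by field; rewrite gt_eqF.
rewrite ler_wpM2l ?divr_ge0 ?mulr_ge0 ?(ltW c0) ?(ltW D0)//.
rewrite ge0_ler_powR ?nnegrE ?subr_ge0 ?(ltW Dr) ?(ltW Dn)//.
by rewrite ler_wpM2l ?(ltW D0)// lef_pV2 ?posrE// mulr_gt0.
Qed.

(** The value of [C] solves c n (C n^al / (2 n))^k = (K + 10) n^b, and 10 collects
the three deviations of at most 2 n^b each and the two paddings by 2. *)
Lemma typical_geodesics (c K C : R) (n : nat) om p v :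
  0 < c -> (forall q, `|q| <= 1 -> c * `|q| `^ k <= bend tau q) ->
  (0 < n)%N -> 0 <= K -> 0 < C -> c * (C / 2) `^ k = K + 10 ->
  tau (n, n) <= n%:R * gamma + K * n%:R `^ b ->
  ~~ atypical w ((2 * n)%:R `^ b) (n, n) om ->
  geodesic om (n, n) p -> v \in origin :: p ->
  `|v.1%:R - v.2%:R| <= C * n%:R `^ ((2 * k + 2) / (2 * k + 3)).
Proof.
have k1 := k_ge1; move=> c0 hc n0 K0 C0 CE rate typ [dp pE] vp.
have [v12|v12] := eqVneq v.1 v.2.
  by rewrite v12 subrr normr0 mulr_ge0 ?powR_ge0// ltW.
have b0 : 0 < b := err_exp_gt0 k_ge1; have b1 : b < 1 := err_exp_lt1 k_ge1.
have n1R : 1 <= n%:R :> R by rewrite ler1n.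
have nR : 0 < n%:R :> R by lra.
have [m um hm] := dpath_split om dp vp.
set t := (2 * n)%:R `^ b in typ.
have [h1 h2] := typicalP typ um.
have [h3 _] := typicalP typ (v := (n, n)) (m := origin) (esym (translate0 _)).
have lev : (level v + level m = 2 * n)%N.
  by rewrite -level_translate -um /level /= mul2n addnn.
have lv : (level v <= 2 * n)%N by rewrite -lev leq_addr.
have low1 := mean_ge_bend c0 hc lv v12.
have low2 := mean_ge_diag m.
move: hm; rewrite pE -(ler_nat R) natrD => hm.
set D := `|v.1%:R - v.2%:R| in low1 *.
have nb1 : 1 <= n%:R `^ b.
  have := ge0_ler_powR (ltW b0) _ _ n1R; rewrite powR1 /=.
  by apply; rewrite nnegrE // ltW.
have tb : t <= 2 * n%:R `^ b.
  rewrite /t natrM powRM// ler_wpM2r ?powR_ge0//.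
  by rewrite ler1_powR ?ler1n// ltW.
have upper : c * n%:R * (D / (2 * n%:R)) `^ k <= (K + 10) * n%:R `^ b.
  have levR : (level v)%:R + (level m)%:R = 2 * n%:R :> R by rewrite -natrD lev natrM.
  have : (level v)%:R / 2 * gamma + (level m)%:R / 2 * gamma = n%:R * gamma.
    by rewrite -mulrDl -mulrDl levR; field.
  move: h1 h2 h3; rewrite !ltr_norml -/tau => /andP[? ?] /andP[? ?] /andP[? ?]; lra.
rewrite leNgt; apply/negP => big; move: upper; apply/negP; rewrite -ltNge.
set al := (2 * k + 2) / (2 * k + 3) in big.
have powb : n%:R * (n%:R `^ al / n%:R) `^ k = n%:R `^ b :> R.
  set l := ln (n%:R : R); have nE : n%:R = expR l :> R by rewrite lnK ?posrE.
  have -> : n%:R `^ al / n%:R = expR ((al - 1) * l) :> R.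
    by rewrite powR_expR // -/l nE -expRN -expRD; congr expR; ring.
  rewrite powR_expR ?expR_gt0 // expRK powR_expR // -/l nE -expRD.
  by congr expR; rewrite /al /b /err_exp; field; lra.
have -> : (K + 10) * n%:R `^ b = c * n%:R * (C * n%:R `^ al / (2 * n%:R)) `^ k.
  have -> : C * n%:R `^ al / (2 * n%:R) = (C / 2) * (n%:R `^ al / n%:R).
    by field; rewrite gt_eqF.
  rewrite powRM ?divr_ge0 ?powR_ge0 ?(ltW C0)//.
  by rewrite -CE -powb; ring.
rewrite ltr_pM2l ?mulr_gt0//.
have n2 : 0 < 2 * n%:R :> R by rewrite mulr_gt0.
apply: gt0_ltr_powR; first by lra.
- by rewrite nnegrE divr_ge0 ?(ltW n2)// mulr_ge0 ?powR_ge0 ?(ltW C0).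
- by rewrite nnegrE divr_ge0 ?(ltW n2) // /D normr_ge0.
- by rewrite ltr_pM2r ?invr_gt0.
Qed.

Lemma geodesic_local n :
  local_to (grid (2 * n)) (fun c => geodesic c (n, n)).
Proof.
move=> c c' cc'; apply/funext => p; apply/propext.
have l2 : level (n, n) = (2 * n)%N by rewrite /level /= mul2n addnn.
have fE : fpt c (n, n) = fpt c' (n, n) by apply: (fpt_local _ cc'); rewrite l2.
rewrite /geodesic fE; split => -[dp].
  by rewrite (passage_time_local dp (c' := c')) ?l2.
by rewrite -(passage_time_local dp (c := c)) ?l2.
Qed.

End Geodesics.

Theorem theorem4p1 (R : realType) (d : measure_display) (Om : measurableType d)
    (P : probability Om R) (s : R) (w : vertex -> {RV P >-> bool}) (k : R)
    (s_gt0 : 0 < s) (s_lt1 : s < 1)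
    (w_iid : iid_bernoulli s w)
    (k_ge1 : 1 <= k)
    (k_curv : curvature_power_at11 (shape_function w) k) :
  exists (C a : R) (N : nat), [/\ 0 < C, 0 < a &
    forall n : nat, (N <= n)%N ->
      ((1 - 2 * expR (- (n%:R `^ a)))%:E <= P [set om : Om |
        forall p, geodesic (fun v => w v om) (n, n) p ->
        forall v : vertex, v \in origin :: p ->
          (`|v.1%:R - v.2%:R|
            <= C * n%:R `^ ((2 * k + 2) / (2 * k + 3)) * Num.sqrt (ln n%:R))%R])%E].
Proof.
have [c c0 hc] := bend_ge_power (mean_ge0 s_gt0 s_lt1 w_iid)
  (mean_le_level s_gt0 s_lt1 w_iid) (mean_subadd s_gt0 s_lt1 w_iid)
  (mean_swap w_iid) k_ge1 k_curv.
have [K K0 [N rate]] := mean_diag_le_shape s_gt0 s_lt1 w_iid k_ge1.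
have [L0 L03 HL0] := err_scale_eventually k_ge1.
have k0 : 0 < k by lra.
pose a := prob_exp k; have a0 : 0 < a := prob_exp_gt0 k_ge1.
pose C := 2 * ((K + 10) / c) `^ k^-1.
have Kc : 0 < (K + 10) / c by rewrite divr_gt0//; lra.
have C0 : 0 < C by rewrite mulr_gt0// powR_gt0.
have CE : c * (C / 2) `^ k = K + 10.
  have -> : C / 2 = ((K + 10) / c) `^ k^-1 by rewrite /C mulrC mulKf.
  by rewrite -powRrM mulVf ?gt_eqF// powRr1 ?ltW// mulrC divfK// gt_eqF.
exists C, a, (N + L0)%N; split => // n nN.
have Nn : (N <= n)%N by rewrite (leq_trans (leq_addr L0 N)).
have L0n : (L0 <= n)%N by rewrite (leq_trans (leq_addl N L0)).
have n3 : (3 <= n)%N by rewrite (leq_trans L03).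
have n0 : (0 < n)%N by rewrite (leq_trans _ n3).
have n2n : (n <= 2 * n)%N by rewrite leq_pmull.
have l2 : level (n, n) = (2 * n)%N by rewrite /level /= mul2n addnn.
have [tb p1 _] := HL0 _ (leq_trans L0n n2n).
set t := (2 * n)%:R `^ _ in tb p1.
have l0 : (0 < level (n, n))%N by rewrite l2 (leq_trans n0).
rewrite -l2 in tb p1.
have bad := atypical_prob s_gt0 s_lt1 w_iid l0 tb.
set A := [set om : Om | _].
pose Q c := `[< forall p, geodesic c (n, n) p -> forall v : vertex, v \in origin :: p ->
  (`|v.1%:R - v.2%:R| <= C * n%:R `^ ((2 * k + 2) / (2 * k + 3)) * Num.sqrt (ln n%:R))%R >].
have Ql : local_to (grid (2 * n)) Q.
  by move=> c1 c2 /geodesic_local; rewrite /Q => ->.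
have AQ : A = event w Q by apply/seteqP; split => om /asboolP.
have mA : measurable A by rewrite AQ; exact: measurable_event Ql.
have mbad : measurable (event w (atypical w t (n, n))).
  by apply: measurable_event; exact: atypical_local.
apply: (@le_trans _ _ (P (~` event w (atypical w t (n, n))))).
  rewrite probability_setC// EFinB leeB//; apply: (le_trans bad); rewrite lee_fin.
  apply: (le_trans p1); rewrite ler_wpM2l// ler_expR lerN2 l2.
  by rewrite ge0_ler_powR ?nnegrE ?(ltW a0)// ler_nat.
apply: le_measure; rewrite ?inE//; first exact: measurableC.
move=> om /negP typ p gp v vp.
apply: (le_trans (typical_geodesics s_gt0 s_lt1 w_iid k_ge1 c0 hc n0 K0 C0 CE (rate n Nn) typ gp vp)).
(* The factor sqrt (ln n) is at least 1 since n >= 3 >= exp 1. *)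
rewrite ler_peMr ?mulr_ge0 ?powR_ge0 ?(ltW C0)//.
rewrite -[leLHS]sqrtr1 ler_wsqrtr// -[leLHS](expRK 1) ler_ln ?posrE ?expR_gt0 ?ltr0n//.
by apply: (le_trans (expR1_le3 R)); rewrite ler_nat.
Qed.
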